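(* Let $h:\Phi^c\to\Psi^d$ be a random simple tabulation function whose character tables are mutually independent and each $100$-independent (e.g. fully random). Then: (1) If $\Phi=\Psi=[2^{16}]$, $c=2$, $d=20$, the probability that $h$ is not $100$-unique is at most $1.5\times10^{-42}$. (2) If $\Phi=\Psi=[2^{22}]$, $c=3$, $d=24$, the probability that $h$ is not $100$-unique is at most $1.4\times10^{-49}$. (3) If $\Phi=[2^{16}]$, $\Psi=[2^{32}]$, $c=4$, $d=14$, the probability that $h$ is not $100$-unique is at most $9.0\times10^{-36}$.
   Context: $\Psi=[2^m]$ is identified with $m$-bit strings and $\oplus$ is bitwise exclusive-or applied coordinatewise on $\Psi^d$. A simple tabulation function $h:\Phi^c\to\Psi^d$ is given by character tables $h_0,\dots,h_{c-1}:\Phi\to\Psi^d$ with $h(x)=h_0(x_0)\oplus\cdots\oplus h_{c-1}(x_{c-1})$. A table is $k$-independent if its values on any $k$ distinct arguments are independent and uniform in $\Psi^d$. For $y\in\Psi^d$, $y_j$ is its $j$-th coordinate. $h$ is $k$-unique if every nonempty $X\subseteq\Phi^c$ with $|X|\le k$ has a unique output position character, i.e. some $(j,a)\in[d]\times\Psi$ such that exactly one $x\in X$ has $h(x)_j=a$. *)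

(* Defs.v *)
From HB Require Import structures.
From mathcomp Require Import all_boot all_order all_algebra.
Set Implicit Arguments. Unset Strict Implicit. Unset Printing Implicit Defensive.
Import Order.TTheory GRing.Theory Num.Theory.
Local Open Scope ring_scope.

(* Psi = [2^m], identified with m-bit strings. *)
Definition Psi (m : nat) := {ffun 'I_m -> bool}.
Definition Out (m d : nat) := {ffun 'I_d -> Psi m}.

Definition Tables (Phi : finType) (m c d : nat) := {ffun 'I_c -> {ffun Phi -> Out m d}}.

Definition tab_hash (Phi : finType) (m c d : nat) (T : Tables Phi m c d)
  (x : {ffun 'I_c -> Phi}) : Out m d :=
  [ffun j => [ffun b => \big[addb/false]_(i < c) T i (x i) j b]].

Definition kunique (Phi : finType) (m c d k : nat) (T : Tables Phi m c d) : bool :=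
  [forall X : {set {ffun 'I_c -> Phi}},
     ((X != set0) && (#|X| <= k)%N) ==>
     [exists j : 'I_d, exists a : Psi m,
        #|[set x in X | tab_hash T x j == a]| == 1%N]].

Definition kindep (R : realFieldType) (A B : finType) (k : nat)
  (p : {ffun A -> B} -> R) : Prop :=
  forall (X : {set A}), #|X| = k ->
  forall f : A -> B,
    \sum_(t : {ffun A -> B} | [forall x in X, t x == f x]) p t
      = (#|B|%:R)^-1 ^+ k.

Definition random_table (R : realFieldType) (A B : finType) (k : nat)
  (p : {ffun A -> B} -> R) : Prop :=
  (forall t, 0 <= p t) /\ \sum_t p t = 1 /\ kindep k p.

(* Probability that h is not k-unique, when the c character tables are
   mutually independent with distributions ps i (joint law = product). *)
Definition prob_not_kunique (R : realFieldType) (Phi : finType) (m c d k : nat)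
  (ps : 'I_c -> {ffun Phi -> Out m d} -> R) : R :=
  \sum_(T : Tables Phi m c d | ~~ kunique k T) \prod_(i < c) ps i (T i).

(* Main.v *)
(** If X has no unique position character then, in each coordinate j, every key of X
    collides with another key of X.  A collision says that the table entries over the
    symmetric difference of the two keys xor to 0 in coordinate j.  Rank the chars by
    decreasing popularity in X and call the least popular char of the symmetric
    difference the pivot of this equation.  In each coordinate at most one key of a
    colliding class avoids the pivots, so the pivots meet at least |X|/2 keys; averaging
    over the levels L_t = (chars occurring in more than t keys), some level C carries at
    least d|C|/(2c) equations supported in C with distinct pivots.  Distinct pivots make
    the equations independent, and a union bound over C and over the equations applies.
    The equations are counted in two ways: as products over the positions of pairs of
    chars of C, or as pairs among at most 100 keys over C.

    The case |C| = 2, two chars of one position that agree in s > d/c coordinates, is too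
    likely for this bound.  If s is large the agreement alone is unlikely enough;
    otherwise averaging with weight (c-1)s on the position of the pair and d-s on the
    others gives a level containing the pair that carries enough additional equations.

    The resulting sums are evaluated with rounded binary logarithms. *)

Require Import Defs.
From HB Require Import structures.
From Stdlib Require Import NArith.
From mathcomp Require Import all_boot all_order all_algebra.
From mathcomp Require Import zify ring.
Set Implicit Arguments. Unset Strict Implicit. Unset Printing Implicit Defensive.
Import Order.TTheory GRing.Theory Num.Theory.
Local Open Scope ring_scope.

(** Supplies exact cardinalities: k-independence speaks of exactly k arguments, and key sets and
    systems of equations are counted by their exact size. *)
Lemma pad_set (T : finType) (A S : {set T}) n : A \subset S ->
  (#|A| <= n)%N -> (n <= #|S|)%N -> exists B : {set T}, [/\ A \subset B, B \subset S & #|B| = n].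
Proof.
move=> AS An nS; have : (n - #|A| <= #|S :\: A|)%N by rewrite cardsD (setIidPr AS) leq_sub2r.
move=> /card_geqP[s [us ss sub]].
have sP x : x \in s -> (x \in S) && (x \notin A) by move=> /sub; rewrite inE andbC.
exists (A :|: [set x in s]); split; first exact: subsetUl.
  rewrite subUset AS /=; apply/subsetP => x; rewrite inE => /sP /andP[].
  by [].
rewrite cardsU [_ :&: _](_ : _ = set0); last first.
  apply/setP => x; rewrite !inE; apply/andP => -[xA /sP].
  by rewrite xA andbF.
by rewrite cards0 subn0 cardsE (card_uniqP us) ss subnKC.
Qed.

(** * The joint law of the tables and events that read few entries *)

Section Probability.
Variables (R : realFieldType) (Phi : finType) (m c d k : nat).
Variable ps : 'I_c -> {ffun Phi -> Out m d} -> R.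
Hypothesis hps : forall i, random_table k (ps i).
Hypothesis hPhi : (k <= #|Phi|)%N.

Definition joint_weight (T : Tables Phi m c d) : R := \prod_(i < c) ps i (T i).

Definition Pr (E : pred (Tables Phi m c d)) : R := \sum_(T | E T) joint_weight T.

Lemma joint_weight_ge0 T : 0 <= joint_weight T.
Proof. by apply: prodr_ge0 => i _; case: (hps i) => ->. Qed.

Lemma Pr_le (E F : pred (Tables Phi m c d)) :
  (forall T, E T -> F T) -> Pr E <= Pr F.
Proof.
move=> EF; rewrite /Pr [leRHS](bigID E) /= -[leLHS]addr0.
apply: lerD; last by apply: sumr_ge0 => T _; apply: joint_weight_ge0.
rewrite le_eqVlt; apply/orP; left; apply/eqP; apply: eq_bigl => T.
by case: (boolP (E T)) => [/EF->|]; rewrite ?andbF.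
Qed.

Lemma Pr_or (E F : pred (Tables Phi m c d)) :
  Pr (fun T => E T || F T) <= Pr E + Pr F.
Proof.
rewrite /Pr [\sum_(T | E T || F T) _](bigID E) /=; apply: lerD.
  rewrite le_eqVlt; apply/orP; left; apply/eqP; apply: eq_bigl => T.
  by case: (E T); rewrite ?andbF.
apply: (@Pr_le (fun T => (E T || F T) && ~~ E T)) => T /=.
by case: (E T); rewrite ?andbF ?andbT.
Qed.

Lemma Pr_exists (I : finType) (P : pred I) (E : I -> pred (Tables Phi m c d)) :
  Pr (fun T => [exists (i | P i), E i T]) <= \sum_(i | P i) Pr (E i).
Proof.
rewrite /Pr (exchange_big_dep xpredT) //= [leLHS]big_mkcond /=.
apply: ler_sum => T _; case: ifP => [/existsP[i /andP[Pi Ei]]|_].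
  rewrite (bigD1 i) ?Pi //= lerDl.
  by apply: sumr_ge0 => j _; apply: joint_weight_ge0.
by apply: sumr_ge0 => j _; apply: joint_weight_ge0.
Qed.

Lemma Pr_existsT (I : finType) (E : I -> pred (Tables Phi m c d)) :
  Pr (fun T => [exists i, E i T]) <= \sum_i Pr (E i).
Proof.
by apply: le_trans (Pr_exists xpredT E); apply: Pr_le => T /existsP[i h]; apply/existsP; exists i.
Qed.

Lemma Pr_setT : Pr xpredT = 1.
Proof.
rewrite /Pr /joint_weight -(bigA_distr_bigA (fun i t => ps i t)) /=.
by rewrite big1 // => i _; case: (hps i) => _ [].
Qed.

Definition agree_on (A : {set 'I_c * Phi}) (T T' : Tables Phi m c d) :=
  [forall g in A, T g.1 g.2 == T' g.1 g.2].

Definition fiber (A : {set 'I_c * Phi}) (i : 'I_c) := [set x | (i, x) \in A].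

(** Whatever values are prescribed at A, the completions form a product of families in which A alone
    decides which factors are singletons. *)
Lemma card_agree_on (A : {set 'I_c * Phi}) (T T' : Tables Phi m c d) :
  #|[pred U | agree_on A T U]| = #|[pred U | agree_on A T' U]|.
Proof.
pose F (T : Tables Phi m c d) i x :=
  if (i, x) \in A then pred1 (T i x) else predT.
have E U : [pred V | agree_on A U V] =i family (fun i => family (F U i)).
  move=> V; rewrite !inE; apply/forall_inP/familyP => [H i|H [i x] gA].
    apply/familyP => x; rewrite /F; case: ifP => // gA.
    by rewrite inE eq_sym; apply: (H (i, x)).
  by have /familyP/(_ x) := H i; rewrite /F gA inE eq_sym.
rewrite (eq_card (E T)) (eq_card (E T')) !card_family.
congr foldr; apply: eq_map => i; rewrite !card_family.
congr foldr; apply: eq_map => x.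
by rewrite /F; case: ifP => _ //; rewrite !card1.
Qed.

(** By k-independence all prescriptions of exactly k entries in each table are equally likely, so an
    event that reads at most k entries of each table is as likely as under uniform tables.
    Probabilities thereby become counts of tables. *)
Lemma Pr_local (A : {set 'I_c * Phi}) (E : pred (Tables Phi m c d)) :
  (forall i, (#|fiber A i| <= k)%N) ->
  (forall T T', agree_on A T T' -> E T = E T') ->
  Pr E * #|{: Tables Phi m c d}|%:R = #|E|%:R.
Proof.
move=> hA hE.
have [B AB Bk] : exists2 B : {set 'I_c * Phi}, A \subset B
    & forall i, #|fiber B i| = k.
  have hPhi' : (k <= #|[set: Phi]|)%N by rewrite cardsT.
  have h i := pad_set (subsetT _) (hA i) hPhi'.
  have h' i : exists B : {set Phi}, (fiber A i \subset B) && (#|B| == k).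
    by have [B [AB _ BK]] := h i; exists B; rewrite AB BK /=.
  exists [set g | g.2 \in xchoose (h' g.1)].
    apply/subsetP => -[i x] gA; rewrite inE /=.
    by have /andP[/subsetP H _] := xchooseP (h' i); apply: H; rewrite inE.
  move=> i; have /andP[_ /eqP e] := xchooseP (h' i).
  by apply: etrans e; apply: eq_card => x; rewrite !inE.
have hEB T T' : agree_on B T T' -> E T = E T'.
  move=> /forall_inP H; apply: hE; apply/forall_inP => g gA.
  by apply: H; apply: (subsetP AB).
pose K := ((#|{: Out m d}|%:R)^-1 ^+ k : R) ^+ c.
have PrB T : Pr (agree_on B T) = K.
  rewrite /Pr /joint_weight /K.
  rewrite (eq_bigl (fun U : Tables Phi m c d => U \in family (fun i =>
     [pred t : {ffun Phi -> Out m d} | [forall x in fiber B i, t x == T i x]]))); last first.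
    move=> U; apply/forall_inP/familyP => [H i|H [i x] gB].
      rewrite inE; apply/forall_inP => x; rewrite inE eq_sym => gB.
      exact: (H (i, x)).
    have := H i; rewrite inE => /forall_inP/(_ x); rewrite inE eq_sym.
    exact.
  rewrite -(bigA_distr_big_dep _ (fun i t => ps i t)) /=.
  rewrite -[in RHS](card_ord c) -prodr_const.
  apply: eq_bigr => i _.
  by case: (hps i) => _ [_ /(_ _ (Bk i) (T i))] <-.
have agree_sym T U : agree_on B T U = agree_on B U T.
  by apply/eq_forallb => g; rewrite eq_sym.
(* Double counting of the pairs (T, U) that agree on B with T in F, equivalently with U in F, each
   weighted by the joint weight of U. *)
have dc (F : pred (Tables Phi m c d)) : (forall T T', agree_on B T T' -> F T = F T') ->
  forall T0, Pr F * #|[pred U | agree_on B T0 U]|%:R = #|F|%:R * K.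
  move=> hF T0; rewrite -[in RHS]sum1_card [in RHS]natr_sum !mulr_suml /=.
  transitivity (\sum_(T | F T) \sum_(U | agree_on B T U) joint_weight U).
    rewrite (exchange_big_dep F) /=; last by move=> T U FT /hF <-.
    apply: eq_bigr => U FU; rewrite sumr_const -[RHS]mulr_natr.
    congr (_ * _%:R); rewrite (card_agree_on B T0 U); apply: eq_card => V.
    rewrite !inE agree_sym; rewrite [RHS]unfold_in /=.
    case: (boolP (agree_on B V U)) => [h|_]; last by rewrite andbF.
    by rewrite (hF _ _ h) FU.
  by apply: eq_bigr => T _; rewrite mul1r -(PrB T).
case: (pickP (xpredT : pred (Tables Phi m c d))) => [T0 _|no]; last first.
  by rewrite (eq_card0 (A := E)) ?(eq_card0 (A := {: Tables Phi m c d})) ?mulr0 // => T; have := no T.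
(* Comparing E with the sure event eliminates the number of completions; K can then be cancelled
   because it is not 0. *)
have h1 := dc E hEB T0; have h2 := dc xpredT (fun _ _ _ => erefl) T0.
rewrite Pr_setT mul1r in h2.
have Kn0 : K != 0.
  rewrite -[K](PrB T0); apply/negP => /eqP K0.
  have := h2; rewrite -(PrB T0) K0 mulr0 => /eqP; rewrite pnatr_eq0.
  move=> /eqP/card0_eq/(_ T0); rewrite !inE => /negP; apply.
  by apply/forall_inP.
by move: h1; rewrite h2 mulrA => /(mulIf Kn0).
Qed.

End Probability.

(** * Linear equations between table entries *)

Section Constraints.
Variables (Phi : finType) (m c d : nat).
Notation char := ('I_c * Phi)%type.
Notation cstr := ('I_d * {set char})%type.

(** A constraint (j, S) is a homogeneous linear equation over the field of two elements with support
    S, imposed on every bit of coordinate j. *)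
Definition sat (T : Tables Phi m c d) (e : cstr) : bool :=
  [forall b, ~~ \big[addb/false]_(g in e.2) T g.1 g.2 e.1 b].

Definition sats (T : Tables Phi m c d) (D : {set cstr}) := [forall e in D, sat T e].

(** Independence expressed as a count: at most a fraction |Psi|^(-|D|) of all tables solves the
    system. *)
Definition good (D : {set cstr}) :=
  (#|[set T | sats T D]| * #|{: Psi m}| ^ #|D| <= #|{: Tables Phi m c d}|)%N.

Definition is_top (rk : char -> nat) (g : char) (S : {set char}) :=
  (g \in S) && [forall g' in S, (rk g' <= rk g)%N].

(** Echelon form: within one coordinate no two equations share their leading char. *)
Definition triangular (rk : char -> nat) (D : {set cstr}) :=
  {in D, forall e : cstr, e.2 != set0} /\
  {in D &, forall e e' : cstr, forall g, e.1 = e'.1 -> is_top rk g e.2 -> is_top rk g e'.2 -> e = e'}.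

Lemma triangularS rk (D D' : {set cstr}) :
  D' \subset D -> triangular rk D -> triangular rk D'.
Proof.
move=> /subsetP DD' [h1 h2]; split; first by move=> e /DD' /h1.
by move=> e e' /DD' eD /DD' eD' g; apply: h2.
Qed.

Definition shift (T : Tables Phi m c d) (g : char) (j : 'I_d) (a : Psi m) : Tables Phi m c d :=
  [ffun i => [ffun x => [ffun j' => [ffun b =>
     T i x j' b (+) [&& (i, x) == g, j' == j & a b]]]]].

Lemma xor_shift T g j a (S : {set char}) j' b :
  \big[addb/false]_(h in S) shift T g j a h.1 h.2 j' b =
  \big[addb/false]_(h in S) T h.1 h.2 j' b (+) [&& g \in S, j' == j & a b].
Proof.
under eq_bigr => h _ do rewrite !ffunE -surjective_pairing.
rewrite big_split /=; congr addb.
case: (boolP (g \in S)) => gS; last first.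
  by rewrite big1 // => h hS; case: eqP => // e; rewrite e (negPf gS) in hS.
by rewrite (bigD1 g) //= eqxx big1 ?addbF // => h /andP[_ /negPf ->].
Qed.

(** Xoring an arbitrary a into the entry g, in the coordinate of e0, turns a solution of D into a
    solution of the remaining equations, since none of them reads that entry. The solution and a can
    both be recovered from the result. *)
Lemma sat_card_step (D : {set cstr}) (e0 : cstr) (g : char) :
  e0 \in D -> g \in e0.2 ->
  {in D :\ e0, forall e : cstr, e.1 = e0.1 -> g \notin e.2} ->
  (#|[set T | sats T D]| * #|{: Psi m}| <= #|[set T | sats T (D :\ e0)]|)%N.
Proof.
move=> e0D ge0 gD; pose f (x : Tables Phi m c d * Psi m) := shift x.1 g e0.1 x.2.
rewrite -cardsT -cardsX -(@card_in_imset _ _ f); last first.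
  move=> [T a] [T' a'] /setXP[/= hT _] /setXP[/= hT' _]; rewrite /f /= => E.
  (* The equation e0 held before the shift, so after it the xor over [e0.2] equals a. *)
  have aa : a = a'.
    apply/ffunP => b; have := congr1 (fun U : Tables Phi m c d =>
      \big[addb/false]_(h in e0.2) U h.1 h.2 e0.1 b) E.
    rewrite !xor_shift ge0 eqxx /=.
    move: hT hT'; rewrite !inE => /forall_inP/(_ _ e0D)/forallP/(_ b)/negPf ->.
    by move=> /forall_inP/(_ _ e0D)/forallP/(_ b)/negPf ->.
  congr (_, _) => //; apply/ffunP => i; apply/ffunP => x; apply/ffunP => j; apply/ffunP => b.
  have := congr1 (fun U : Tables Phi m c d => U i x j b) E.
  by rewrite !ffunE aa => /addIb.
apply/subset_leq_card/subsetP => U /imsetP[[T a] /setXP[/= hT _] ->].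
rewrite inE; apply/forall_inP => e eD; apply/forallP => b; rewrite /f /= xor_shift.
have [eD' ee0] : e \in D /\ e != e0 by move: eD; rewrite !inE => /andP[].
move: hT; rewrite inE => /forall_inP/(_ _ eD')/forallP/(_ b)/negPf -> /=.
case: (eqVneq e.1 e0.1) => [h|_]; rewrite ?andbF //.
by rewrite (negPf (gD _ eD h)).
Qed.

(* Flipping the table at the top of the constraint of largest top affects no other
   constraint, so each constraint costs a factor |Psi|. *)
Lemma triangular_good rk (D : {set cstr}) : triangular rk D -> good D.
Proof.
move En : #|D| => n; elim: n D En => [|n IH] D Dn.
  by move=> _; rewrite /good Dn expn0 muln1 max_card.
have [e1 e1D] : exists e, e \in D by apply/set0Pn; rewrite -card_gt0 Dn.
move=> tri; case: (tri) => h1 h2.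
case: (arg_maxnP (fun e : cstr => \max_(g in e.2) rk g)%N e1D) => e0 e0D' e0max.
have e0D : e0 \in D := e0D'.
have [g ge0 gmax] := eq_bigmax_cond rk (etrans (card_gt0 _) (h1 _ e0D)).
have topg e : e \in D -> g \in e.2 -> is_top rk g e.2.
  move=> eD ge; rewrite /is_top ge; apply/forall_inP => g' g'e.
  rewrite -gmax; apply: leq_trans (e0max _ eD).
  exact: (@leq_bigmax_cond _ (mem e.2) rk).
have step := @sat_card_step D e0 g e0D ge0.
have Dn' : #|D :\ e0| = n by move: Dn; rewrite (cardsD1 e0) e0D => -[].
have := IH _ Dn' (triangularS (subD1set _ _) tri).
rewrite /good Dn Dn' expnS mulnA; apply: leq_trans; rewrite leq_mul2r step ?orbT //.
move=> e; rewrite !inE => /andP[ne eD] ej; apply/negP => ge.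
by rewrite (h2 _ _ eD e0D g ej) ?eqxx ?topg in ne.
Qed.

Variables (R : realFieldType) (k : nat).
Variable ps : 'I_c -> {ffun Phi -> Out m d} -> R.
Hypothesis hps : forall i, random_table k (ps i).
Hypothesis hPhi : (k <= #|Phi|)%N.

(** The equations read only entries at A, so [Pr_local] turns the count in [good] into a
    probability. *)
Lemma Pr_sats (A : {set char}) (D : {set cstr}) :
  (forall i, (#|fiber A i| <= k)%N) -> {in D, forall e : cstr, e.2 \subset A} -> good D ->
  Pr ps (fun T => sats T D) <= #|{: Psi m}|%:R^-1 ^+ #|D|.
Proof.
move=> hA DA gD.
have loc T T' : agree_on A T T' -> sats T D = sats T' D.
  move=> /forall_inP h; apply/eq_forallb => e; case: (boolP (e \in D)) => //= eD.
  apply/eq_forallb => b; congr (~~ _); apply: eq_bigr => g ge.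
  by rewrite (eqP (h g (subsetP (DA e eD) g ge))).
have := Pr_local hps hPhi hA loc.
have T0 : 0 < #|{: Tables Phi m c d}|%:R :> R.
  by rewrite ltr0n; apply/card_gt0P; exists [ffun=> [ffun=> [ffun=> [ffun=> false]]]].
have q0 : 0 < #|{: Psi m}|%:R :> R.
  by rewrite ltr0n; apply/card_gt0P; exists [ffun=> false].
move=> /(canRL (mulfK (lt0r_neq0 T0))) ->.
rewrite ler_pdivrMr // exprVn ler_pdivlMl ?exprn_gt0 //.
rewrite -natrX -natrM ler_nat mulnC.
move: gD; rewrite /good; congr (_ * _ <= _)%N.
by apply: eq_card => T; rewrite !inE.
Qed.

End Constraints.

(** * Supports of collisions and the number of candidate systems *)

Section Witnesses.
Variables (Phi : finType) (m c d : nat).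
Notation char := ('I_c * Phi)%type.
Notation key := {ffun 'I_c -> Phi}.
Notation cstr := ('I_d * {set char})%type.

(** Keys are viewed as sets of chars, one per position; this is their symmetric difference. *)
Definition delta (x y : key) : {set char} := [set g | (x g.1 == g.2) (+) (y g.1 == g.2)].

Lemma sat_delta (T : Tables Phi m c d) j x y :
  sat T (j, delta x y) = (tab_hash T x j == tab_hash T y j).
Proof.
have xorE (z : key) b : tab_hash T z j b = \big[addb/false]_g ((z g.1 == g.2) && T g.1 g.2 j b).
  rewrite /tab_hash !ffunE.
  rewrite -(pair_bigA _ (fun i a => (z i == a) && T i a j b)) /=.
  apply: eq_bigr => i _; rewrite (bigD1 (z i)) //= eqxx /= big1 ?addbF // => a /negPf.
  by rewrite eq_sym => ->.
have E b : \big[addb/false]_(g in delta x y) T g.1 g.2 j b = tab_hash T x j b (+) tab_hash T y j b.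
  rewrite !xorE -big_split /= big_mkcond /=; apply: eq_bigr => g _.
  by rewrite inE; do 2!case: eqP; case: (T _ _ _ _).
apply/forallP/eqP => [h|h b].
  by apply/ffunP => b; move: (h b); rewrite /= E; do 2!case: (tab_hash _ _ _ _).
by rewrite /= E h addbb.
Qed.

Lemma fiber_delta x y i :
  fiber (delta x y) i = if x i == y i then set0 else [set x i; y i].
Proof.
apply/setP => a; rewrite !inE /=; case: (eqVneq (x i) (y i)) => [->|ne].
  by rewrite addbb inE.
rewrite !inE ![a == _]eq_sym; case: (eqVneq (x i) a) ne => [<-|] //=.
by rewrite eq_sym => /negPf ->.
Qed.

(** All subsets of C with the shape of a difference of two keys, which has either no char or two
    chars in each position. *)
Definition kdiffs (C : {set char}) : {set {set char}} :=
  [set S : {set char} | (S \subset C) && [forall i, (fiber S i == set0) || (#|fiber S i| == 2%N)]].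

Lemma delta_kdiffs x y (C : {set char}) : delta x y \subset C -> delta x y \in kdiffs C.
Proof.
move=> sC; rewrite inE sC /=; apply/forallP => i; rewrite fiber_delta.
by case: (eqVneq (x i) (y i)) => [_|ne]; rewrite ?eqxx // cards2 ne orbT.
Qed.

Lemma fiberS (C D : {set char}) i : C \subset D -> fiber C i \subset fiber D i.
Proof. by move=> /subsetP s; apply/subsetP => a; rewrite !inE => /s. Qed.

Lemma fiber_inj (S S' : {set char}) : (forall i, fiber S i = fiber S' i) -> S = S'.
Proof. by move=> h; apply/setP => -[i a]; have /setP/(_ a) := h i; rewrite !inE. Qed.

Lemma card_family_prod (F : 'I_c -> {set Phi}) : #|family F| = (\prod_i #|F i|)%N.
Proof. by rewrite card_family foldrE big_map big_enum. Qed.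

Definition nvectors (C : {set char}) := (\prod_(i < c) (1 + 'C(#|fiber C i|, 2)))%N.

Lemma card_kdiffs C : (#|kdiffs C| <= nvectors C)%N.
Proof.
pose F i : {set {set Phi}} := set0 |: [set B : {set Phi} | B \subset fiber C i & #|B| == 2%N].
pose f (S : {set char}) := [ffun i => fiber S i].
have f_inj : injective f.
  by move=> S S' /ffunP h; apply: fiber_inj => i; have := h i; rewrite !ffunE.
rewrite -(card_imset _ f_inj).
have : (#|[set f S | S in kdiffs C]| <= #|family F|)%N.
  apply/subset_leq_card/subsetP => _ /imsetP[S + ->].
  rewrite inE => /andP[sC /forallP h]; apply/familyP => i.
  by rewrite ffunE !inE (fiberS i sC).
move/leq_trans; apply.
rewrite card_family foldrE big_map big_enum /=; apply: leq_prod => i _.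
by apply: leq_trans (leq_card_setU _ _) _; rewrite cards1 cards_draws.
Qed.

(** For a set of two keys this is their [delta]; working with unordered pairs bounds the number of
    differences by a binomial coefficient. *)
Definition xor_keys (B : {set key}) : {set char} :=
  [set g : char | #|[set x in B | x g.1 == g.2]| == 1].

Definition diffs (Q : {set key}) : {set {set char}} :=
  [set xor_keys B | B in [set B : {set key} | B \subset Q & #|B| == 2%N]].

Lemma diffsS (Q Q' : {set key}) : Q \subset Q' -> diffs Q \subset diffs Q'.
Proof.
move=> QQ; apply: imsetS; apply/subsetP => B; rewrite !inE => /andP[h ->].
by rewrite (subset_trans h QQ).
Qed.

Lemma card_diffs Q : (#|diffs Q| <= 'C(#|Q|, 2))%N.
Proof. by rewrite -cards_draws leq_imset_card. Qed.

Lemma delta_diffs (Q : {set key}) x y : x \in Q -> y \in Q -> x != y -> delta x y \in diffs Q.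
Proof.
move=> xQ yQ ne; apply/imsetP; exists [set x; y].
  by rewrite inE cards2 ne eqxx andbT; apply/subsetP => z /set2P[] ->.
apply/setP => g; rewrite !inE -sum1_card.
rewrite (eq_bigl (fun z => (z \in [set x; y]) && (z g.1 == g.2))); last by move=> z; rewrite inE.
rewrite big_mkcondr big_setU1 ?big_set1 ?inE //=.
by do 2!case: eqP.
Qed.

Variable x0 : Phi.

Definition default_char (C : {set char}) i := if [pick a in fiber C i] is Some a then a else x0.

(** Chars outside C give way to one default per position. Differences inside C survive by
    [delta_fill], so the keys behind the equations may be assumed to lie in [keys_on C]. *)
Definition fill (C : {set char}) (x : key) : key :=
  [ffun i => if (i, x i) \in C then x i else default_char C i].

Definition keys_on (C : {set char}) : {set key} :=
  [set x in family (fun i => if fiber C i == set0 then [set x0] else fiber C i)].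

Lemma fill_keys_on (C : {set char}) x : fill C x \in keys_on C.
Proof.
rewrite inE; apply/familyP => i; rewrite ffunE /default_char.
case: ifP => [h|_].
  case: ifP => [/eqP e|_]; last by rewrite inE.
  have xC : x i \in fiber C i by rewrite inE.
  by rewrite e inE in xC.
case: pickP => [a aC|no]; first by case: ifP => // /eqP e; rewrite e inE in aC.
by rewrite ifT ?inE //; apply/eqP/setP => a; rewrite no inE.
Qed.

Lemma delta_fill (C : {set char}) x y : delta x y \subset C -> delta (fill C x) (fill C y) = delta x y.
Proof.
move=> sC; apply: fiber_inj => i; rewrite !fiber_delta !ffunE.
case: (eqVneq (x i) (y i)) => [->|ne]; first by rewrite eqxx.
have hx : (i, x i) \in C by apply: (subsetP sC); rewrite !inE /= eqxx eq_sym (negPf ne).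
have hy : (i, y i) \in C by apply: (subsetP sC); rewrite !inE /= eqxx (negPf ne).
by rewrite hx hy (negPf ne).
Qed.

Definition nkeys (C : {set char}) := (\prod_(i < c) maxn #|fiber C i| 1)%N.

Lemma card_keys_on C : #|keys_on C| = nkeys C.
Proof.
rewrite cardsE card_family_prod; apply: eq_bigr => i _.
case: eqP => [->|/eqP h]; first by rewrite cards1 cards0.
by rewrite (maxn_idPl _) // card_gt0.
Qed.

Variable k : nat.

(** The supports lie in C, avoid the excluded family E and come from a single set Q of at most k
    keys. This allows two counts: forgetting Q, or choosing Q first and then pairs of its keys. *)
Definition candidates (C : {set char}) (E : {set {set char}}) g : {set {set cstr}} :=
  [set D : {set cstr} | [&& #|D| == g, D \subset setX setT (kdiffs C :\: E) &
    [exists Q : {set key}, [&& (#|Q| <= k)%N, Q \subset keys_on C & D \subset setX setT (diffs Q)]]]].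

Lemma card_candidates_vectors (C : {set char}) (E : {set {set char}}) g : E \subset kdiffs C ->
  (#|candidates C E g| <= 'C(d * (nvectors C - #|E|), g))%N.
Proof.
move=> EC; apply: (@leq_trans 'C(#|setX [set: 'I_d] (kdiffs C :\: E)|, g)).
  rewrite -cards_draws; apply/subset_leq_card/subsetP => D; rewrite !inE.
  by case/and3P => -> ->.
apply: leq_bin2l; rewrite cardsX cardsT card_ord leq_mul2l cardsD (setIidPr EC).
by rewrite leq_sub2r ?orbT ?card_kdiffs.
Qed.

Lemma card_bigcup_leq (I T : finType) (P : {set I}) (F : I -> {set T}) M :
  (forall i, i \in P -> (#|F i| <= M)%N) -> (#|\bigcup_(i in P) F i| <= #|P| * M)%N.
Proof.
move=> h; rewrite -sum_nat_const.
apply: (@leq_trans (\sum_(i in P) #|F i|)%N); last exact: leq_sum.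
elim/big_rec2: _ => [|i s A _ le]; first by rewrite cards0.
by apply: leq_trans (leq_card_setU _ _) _; rewrite leq_add2l.
Qed.

Lemma card_candidates_keys C E g N : (nkeys C <= N)%N -> (k <= N)%N ->
  (#|candidates C E g| <= 'C(N, k) * 'C(d * 'C(k, 2), g))%N.
Proof.
(* Key sets are padded to a common size; if fewer than k keys live on C, a single choice remains. *)
move=> CN kN; set r := minn k (nkeys C).
pose P := [set Q : {set key} | Q \subset keys_on C & #|Q| == r].
pose F (Q : {set key}) := [set D : {set cstr} | D \subset setX setT (diffs Q) & #|D| == g].
apply: (@leq_trans #|\bigcup_(Q in P) F Q|).
  apply/subset_leq_card/subsetP => D; rewrite inE => /and3P[Dg _ /existsP[Q /and3P[Qk QC DQ]]].
  have Qr : (#|Q| <= r)%N by rewrite leq_min Qk -card_keys_on subset_leq_card.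
  have rC : (r <= #|keys_on C|)%N by rewrite card_keys_on geq_minr.
  have [Q' [QQ Q'C Q'r]] := pad_set QC Qr rC.
  apply/bigcupP; exists Q'; first by rewrite inE Q'C Q'r eqxx.
  by rewrite inE Dg andbT (subset_trans DQ) // setXS ?diffsS.
apply: (leq_trans (@card_bigcup_leq _ _ P F 'C(d * 'C(k, 2), g) _)).
  move=> Q; rewrite inE => /andP[_ /eqP Qr]; rewrite cards_draws leq_bin2l //.
  rewrite cardsX cardsT card_ord leq_mul2l; apply/orP; right.
  by apply: (leq_trans (card_diffs Q)); rewrite leq_bin2l // Qr geq_minl.
rewrite leq_mul2r; apply/orP; right.
rewrite cards_draws card_keys_on /r; case: (leqP k (nkeys C)) => h.
  by rewrite leq_bin2l.
by rewrite binn bin_gt0.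
Qed.

Variable R : realFieldType.
Variable ps : 'I_c -> {ffun Phi -> Out m d} -> R.
Hypothesis hps : forall i, random_table k (ps i).
Hypothesis hPhi : (k <= #|Phi|)%N.

Definition witness (C : {set char}) (E : {set {set char}}) (D0 : {set cstr}) g
    (T : Tables Phi m c d) :=
  [exists (D | (D \in candidates C E g) && good m (D0 :|: D)), sats T (D0 :|: D)].

(** Supports of D0 lie in E and supports of D outside E, so the two systems are disjoint and
    together contribute |D0| + g factors 1/|Psi|. The rest is a union bound over D. *)
Lemma Pr_witness (C : {set char}) (E : {set {set char}}) (D0 : {set cstr}) g W : (forall i, (#|fiber C i| <= k)%N) ->
  D0 \subset setX setT E -> {in D0, forall e : cstr, e.2 \subset C} ->
  (#|candidates C E g| <= W)%N ->
  Pr ps (witness C E D0 g) <= W%:R * #|{: Psi m}|%:R^-1 ^+ (#|D0| + g).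
Proof.
move=> hC D0E D0C hW; apply: (le_trans (Pr_exists hps _ _)).
set z := _ ^+ _; have z0 : 0 <= z by rewrite exprn_ge0 ?invr_ge0.
apply: (@le_trans _ _ (\sum_(D in candidates C E g) z)); last first.
  by rewrite sumr_const -[leLHS]mulr_natl ler_wpM2r ?ler_nat.
rewrite big_mkcondr /=; apply: ler_sum => D hD; case: ifP => // gD.
have := hD; rewrite inE => /and3P[/eqP Dg /subsetP DC _].
have -> : z = #|{: Psi m}|%:R^-1 ^+ #|D0 :|: D|.
  congr (_ ^+ _); rewrite cardsU Dg [_ :&: _](_ : _ = set0) ?cards0 ?subn0 //.
  apply/setP => e; rewrite inE [RHS]inE; apply/andP => -[/(subsetP D0E)].
  by rewrite inE => /andP[_ eE] /DC; rewrite !inE eE.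
apply: (Pr_sats hps hPhi hC) gD => e; rewrite inE => /orP[/D0C //|/DC].
by rewrite !inE /= => /andP[_ /andP[]].
Qed.

End Witnesses.

(** * Popularity levels and pivots of a set without unique position characters *)

Section Popularity.
Variables (Phi : finType) (m c d : nat) (T : Tables Phi m c d).
Notation char := ('I_c * Phi)%type.
Notation key := {ffun 'I_c -> Phi}.
Notation cstr := ('I_d * {set char})%type.

Variable X : {set key}.
Hypothesis X_nonunique :
  forall j a, #|[set x in X | tab_hash T x j == a]| != 1%N.

Definition pop (g : char) := #|[set x in X | x g.1 == g.2]|.

(* Chars are ranked by decreasing popularity, so that the top of a set of chars is
   its least popular element and every set whose top lies in a level stays in that level. *)
Definition rank (g : char) : nat := ((#|X| - pop g) * #|{: char}| + enum_rank g)%N.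

Lemma pop_leq g : (pop g <= #|X|)%N.
Proof. by apply/subset_leq_card/subsetP => x; rewrite inE => /andP[]. Qed.

Lemma rank_inj : injective rank.
Proof.
move=> g g' /(congr1 (modn^~ #|{: char}|)); rewrite /rank !modnMDl.
by rewrite !modn_small // => /ord_inj/enum_rank_inj.
Qed.

Lemma rank_pop g g' : (rank g <= rank g')%N -> (pop g' <= pop g)%N.
Proof.
rewrite /rank => h; have := pop_leq g; have := pop_leq g'.
have := ltn_ord (enum_rank g); have := ltn_ord (enum_rank g').
move=> n1 n2 p1 p2; case: (leqP (pop g') (pop g)) => // lt.
have : ((#|X| - pop g').+1 * #|{: char}| <= (#|X| - pop g) * #|{: char}|)%N.
  by rewrite leq_mul2r; apply/orP; right; lia.
move=> H; have := leq_trans (leq_trans H (leq_addr _ _)) h.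
by rewrite mulSnr leq_add2l leqNgt ltn_ord.
Qed.

Lemma exists_top (S : {set char}) : S != set0 -> exists g, is_top rank g S.
Proof.
case/set0Pn => g0 g0S; case: (arg_maxnP rank g0S) => g gS h.
by exists g; rewrite /is_top (gS : g \in S); apply/forall_inP => g' /h.
Qed.

Lemma top_uniq (S : {set char}) g g' : is_top rank g S -> is_top rank g' S -> g = g'.
Proof.
move=> /andP[gS /forall_inP h] /andP[gS' /forall_inP h'].
by apply: rank_inj; apply/eqP; rewrite eqn_leq h ?h'.
Qed.

Lemma delta_neq0 (x y : key) : x != y -> delta x y != set0.
Proof.
apply: contraNneq => e; apply/eqP/ffunP => i; have := fiber_delta x y i.
case: eqP => // _ /setP/(_ (x i)); rewrite e !inE eqxx.
by [].
Qed.

Definition collide (j : 'I_d) (g : char) (p : key * key) :=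
  [&& p.1 \in X, p.2 \in X, p.1 != p.2, tab_hash T p.1 j == tab_hash T p.2 j
    & is_top rank g (delta p.1 p.2)].

Definition pivots (j : 'I_d) := [set g | [exists p, collide j g p]].

(** If two distinct keys collide in coordinate j, the top of their difference is a pivot and belongs
    to one of them. Hence the set B of keys that avoid all pivots is hashed injectively, and
    choosing a colliding partner maps B injectively into its complement in X. Every key of the
    complement contains a pivot. *)
Lemma pivots_pop j : (#|X| <= 2 * \sum_(g in pivots j) pop g)%N.
Proof.
pose B := [set x in X | ~~ [exists g in pivots j, x g.1 == g.2]].
have B_inj : {in B &, injective (fun x => tab_hash T x j)}.
  move=> x y; rewrite !inE => /andP[xX nx] /andP[yX ny] e; apply/eqP; apply: contraT => ne.
  have [g gt] := exists_top (delta_neq0 ne).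
  have gp : g \in pivots j by rewrite inE; apply/existsP; exists (x, y); rewrite /collide /= xX yX ne e eqxx.
  have /andP[] := gt; rewrite inE => + _.
  have nx' : (x g.1 == g.2) = false.
    by apply/negbTE; apply: contra nx => xg; apply/existsP; exists g; rewrite gp.
  have ny' : (y g.1 == g.2) = false.
    by apply/negbTE; apply: contra ny => yg; apply/existsP; exists g; rewrite gp.
  by rewrite nx' ny'.
have mate x : x \in X -> exists2 y, y \in X & (y != x) && (tab_hash T y j == tab_hash T x j).
  move=> xX; have := X_nonunique j (tab_hash T x j).
  rewrite (cardsD1 x) !inE xX eqxx /= eqSS cards_eq0 => /set0Pn[y].
  by rewrite !inE => /and3P[nyx yX e]; exists y; rewrite ?nyx.
pose f x := odflt x [pick y in X | (y != x) && (tab_hash T y j == tab_hash T x j)].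
have fP x : x \in X -> [/\ f x \in X, f x != x & tab_hash T (f x) j = tab_hash T x j].
  move=> /mate[y yX ye]; rewrite /f; case: pickP => [z /and3P[? ? /eqP ?] //|/(_ y)].
  by rewrite yX ye.
have BX : B \subset X by apply/subsetP => x; rewrite inE => /andP[].
have le1 : (#|B| <= #|X :\: B|)%N.
  have f_inj : {in B &, injective f}.
    move=> x y xB yB e; have [_ _ ex] := fP _ (subsetP BX _ xB).
    by have [_ _ ey] := fP _ (subsetP BX _ yB); apply: B_inj => //; rewrite -ex -ey e.
  rewrite -(card_in_imset f_inj); apply/subset_leq_card/subsetP => _ /imsetP[x xB ->].
  have [fX fn fe] := fP _ (subsetP BX _ xB); rewrite inE fX andbT.
  by apply: contra fn => fB; rewrite (B_inj _ _ fB xB fe).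
have le2 : (#|X :\: B| <= \sum_(g in pivots j) pop g)%N.
  have popE g : pop g = (\sum_(x in X) (x g.1 == g.2))%N.
    rewrite /pop -sum1_card (eq_bigl (fun x => (x \in X) && (x g.1 == g.2))).
      by rewrite big_mkcondr; apply: eq_bigr => x _; case: eqP.
    by move=> x; rewrite inE.
  under eq_bigr => g _ do rewrite popE.
  rewrite exchange_big /= -sum1_card [leqRHS](bigID (mem B)) /=.
  apply: (@leq_trans (\sum_(x in X | x \notin B) \sum_(g in pivots j) (x g.1 == g.2))%N); last exact: leq_addl.
  rewrite [leqLHS](eq_bigl (fun x => (x \in X) && (x \notin B))); last by move=> x; rewrite inE andbC.
  apply: leq_sum => x /andP[xX]; rewrite inE xX negbK => /existsP[g /andP[gp e]].
  by rewrite (bigD1 g) //= e.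
by have := cardsID B X; rewrite (setIidPr BX); lia.
Qed.

Definition level t := [set g | (t < pop g)%N].

Lemma levelS t t' : (t <= t')%N -> level t' \subset level t.
Proof. by move=> tt; apply/subsetP => g; rewrite !inE; apply: leq_ltn_trans. Qed.

Lemma sum_ltn n a : (\sum_(t < n) (t < a)%N = minn a n)%N.
Proof. by elim: n => [|n IH]; rewrite ?big_ord0 ?minn0 // big_ord_recr /= IH; lia. Qed.

(** Layer-cake summation: a char of popularity p lies in exactly the levels t < p. *)
Lemma sum_level (A : {set char}) :
  (\sum_(t < #|X|) #|level t :&: A| = \sum_(g in A) pop g)%N.
Proof.
transitivity (\sum_(t < #|X|) \sum_(g in A) (t < pop g)%N)%N.
  apply: eq_bigr => t _; rewrite -sum1_card [LHS](eq_bigl (fun g => (g \in A) && (t < pop g)%N)).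
    by rewrite big_mkcondr; apply: eq_bigr => g _; case: ltnP.
  by move=> g; rewrite !inE andbC.
rewrite exchange_big /=; apply: eq_bigr => g _.
by rewrite sum_ltn (minn_idPl (pop_leq g)).
Qed.

(** Each key has one char in position i, so the popularities of the chars of this position add up to
    |X|. *)
Lemma sum_fiber_level i : (\sum_(t < #|X|) #|fiber (level t) i| = #|X|)%N.
Proof.
transitivity (\sum_(t < #|X|) #|level t :&: [set g : char | g.1 == i]|)%N.
  apply: eq_bigr => t _; rewrite -(card_imset (f := pair i)); last by move=> a b [].
  apply: eq_card => -[i' a]; apply/imsetP/setIP => [[b h [-> ->]]|[h]].
    by move: h; rewrite !inE eqxx.
  by rewrite inE /= => /eqP e; rewrite e in h *; exists a; rewrite // inE.
rewrite sum_level [LHS](eq_bigl (fun g : char => (g.1 == i) && true)); last by move=> g; rewrite inE andbT.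
rewrite -(pair_big_dep (fun i' => i' == i) (fun _ _ => true) (fun i a => pop (i, a))) /=.
rewrite big_pred1_eq.
transitivity (\sum_a \sum_(x in X | x i == a) 1)%N.
  by apply: eq_bigr => a _; rewrite /pop -sum1_card; apply: eq_bigl => x; rewrite inE.
by rewrite -sum1_card -(partition_big (fun x : key => x i) xpredT).
Qed.

Lemma fiber_level_leq t i : (#|fiber (level t) i| <= #|X|)%N.
Proof.
case: (ltnP t #|X|) => tX.
  by rewrite -[leqRHS](sum_fiber_level i) (bigD1 (Ordinal tX)) //= leq_addr.
rewrite (_ : fiber _ _ = set0) ?cards0 //; apply/setP => a; rewrite !inE.
by apply/negbTE; rewrite -leqNgt (leq_trans (pop_leq _)).
Qed.

Definition gain t := (\sum_(j < d) #|level t :&: pivots j|)%N.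

Definition weight (w : 'I_c -> nat) (C : {set char}) := (\sum_i w i * #|fiber C i|)%N.

(** Over all levels, every position contributes |X| chars, while in every coordinate the pivots
    contribute at least |X| / 2 by [pivots_pop]. *)
Lemma sum_weight_gain (w : 'I_c -> nat) K : (\sum_i w i = K * d)%N ->
  (\sum_(t < #|X|) weight w (level t) <= \sum_(t < #|X|) 2 * K * gain t)%N.
Proof.
move=> wK; rewrite /weight exchange_big /=.
have -> : (\sum_i \sum_(t < #|X|) w i * #|fiber (level t) i| = K * d * #|X|)%N.
  rewrite -wK big_distrl /=; apply: eq_bigr => i _.
  by rewrite -big_distrr /= sum_fiber_level.
rewrite -big_distrr /= /gain exchange_big /=.
have : (d * #|X| <= \sum_(j < d) 2 * \sum_(t < #|X|) #|level t :&: pivots j|)%N.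
  rewrite -[d in (d * _)%N]card_ord -sum_nat_const; apply: leq_sum => j _.
  by rewrite sum_level pivots_pop.
by rewrite -big_distrr /=; nia.
Qed.

(** If all levels in P fell strictly short of the average, those outside P could not make up for it;
    the lowest level is in P and makes the contradiction strict. *)
Lemma heavy_level (w : 'I_c -> nat) K (P : pred nat) : (\sum_i w i = K * d)%N ->
  X != set0 -> P 0%N -> (forall t, ~~ P t -> 2 * K * gain t <= weight w (level t))%N ->
  exists2 t, P t & (weight w (level t) <= 2 * K * gain t)%N.
Proof.
move=> wK X0 P0 nP; have le := sum_weight_gain wK.
have X1 : (0 < #|X|)%N by rewrite card_gt0.
have [/existsP[t /andP[Pt h]]|no] := boolP [exists t : 'I_#|X|,
   P t && (weight w (level t) <= 2 * K * gain t)%N]; first by exists t.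
suff : (\sum_(t < #|X|) 2 * K * gain t < \sum_(t < #|X|) weight w (level t))%N by lia.
have small (t : 'I_#|X|) : P t -> (2 * K * gain t < weight w (level t))%N.
  move=> Pt; rewrite ltnNge; apply: contra no => h.
  by apply/existsP; exists t; rewrite Pt.
rewrite (bigD1 (Ordinal X1)) //= [ltnRHS](bigD1 (Ordinal X1)) //= -addSn.
apply: leq_add; first exact: (small (Ordinal X1)).
by apply: leq_sum => t _; case: (boolP (P t)) => [/small/ltnW|/nP].
Qed.

Definition chosen (j : 'I_d) (g : char) : {set char} :=
  if [pick p | collide j g p] is Some p then delta p.1 p.2 else set0.

Lemma chosenP j g : g \in pivots j -> exists2 p, collide j g p & chosen j g = delta p.1 p.2.
Proof.
rewrite inE /chosen => /existsP[p hp]; case: pickP => [p' hp'|/(_ p)]; last by rewrite hp.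
by exists p'.
Qed.

Definition level_pivots t := [set p : 'I_d * char | p.2 \in level t :&: pivots p.1].

Definition system t : {set cstr} := [set (p.1, chosen p.1 p.2) | p in level_pivots t].

Lemma chosen_top j g : g \in pivots j -> is_top rank g (chosen j g).
Proof. by case/chosenP => p /and5P[_ _ _ _ h] ->. Qed.

(** The pivot is recovered as the top of the chosen support, so distinct pivots give distinct
    equations. *)
Lemma card_system t : #|system t| = gain t.
Proof.
rewrite card_in_imset; last first.
  move=> [j g] [j' g']; rewrite inE => /setIP[_ /chosen_top gt].
  rewrite inE => /setIP[_ /chosen_top gt'] /= [jj e].
  by rewrite -e in gt'; rewrite -jj; congr pair; exact: top_uniq gt gt'.
rewrite -sum1_card [LHS](eq_bigl (fun p : 'I_d * char => true && (p.2 \in level t :&: pivots p.1))); last by move=> p; rewrite inE.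
rewrite -(pair_big_dep xpredT (fun j g => g \in level t :&: pivots j) (fun _ _ => 1%N)) /=.
by apply: eq_bigr => j _; rewrite sum1_card.
Qed.

Lemma system_triangular t : triangular rank (system t).
Proof.
split=> [e|e e'].
  case/imsetP => -[j g]; rewrite inE /= => /setIP[_ /chosen_top/andP[gc _]] ->.
  by apply/set0Pn; exists g.
case/imsetP => -[j g]; rewrite inE /= => /setIP[_ /chosen_top gt] ->.
case/imsetP => -[j' g']; rewrite inE /= => /setIP[_ /chosen_top gt'] -> g0 /= jj t1 t2.
by rewrite -jj in gt' t2 *; rewrite (top_uniq gt t1) (top_uniq gt' t2).
Qed.

(** The pivot lies in the level and is the least popular char of the support, so the whole support
    lies in the level. *)
Lemma systemP t (e : cstr) : e \in system t -> e.2 \subset level t /\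
  exists p : key * key, [/\ p.1 \in X, p.2 \in X, p.1 != p.2, sat T e & e.2 = delta p.1 p.2].
Proof.
case/imsetP => -[j g]; rewrite inE /= => /setIP[gl gp] ->; split.
  have /andP[_ /forall_inP h] := chosen_top gp.
  apply/subsetP => g' /h /rank_pop le; move: gl; rewrite !inE /=.
  by move/leq_trans; apply.
have [p /and5P[x1 x2 ne he _] ep] := chosenP gp.
by exists p; rewrite ep sat_delta.
Qed.

Lemma systemS t t' : (t <= t')%N -> system t' \subset system t.
Proof.
move=> tt; apply: imsetS; apply/subsetP => p; rewrite !inE.
by case/andP => h ->; rewrite (leq_ltn_trans tt h).
Qed.

Lemma card_delta (x y : key) : x != y -> (1 < #|delta x y|)%N.
Proof.
move=> ne; have [i ni] : exists i, x i != y i.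
  apply/existsP; apply: contraNT ne; rewrite negb_exists => /forallP h.
  by apply/eqP/ffunP => i; have := h i; rewrite negbK => /eqP.
apply: (@leq_trans #|[set (i, x i); (i, y i)]|).
  by rewrite cards2 xpair_eqE eqxx /= ni.
apply/subset_leq_card/subsetP => g /set2P[] ->; rewrite inE /= eqxx.
  by rewrite eq_sym (negPf ni).
by rewrite (negPf ni).
Qed.

Lemma gain_small t : (#|level t| <= 1)%N -> gain t = 0%N.
Proof.
move=> l1; rewrite -card_system; apply/eqP; rewrite cards_eq0; apply: contraT.
case/set0Pn => e /systemP[eL [p [_ _ ne _ ep]]].
have := card_delta ne; rewrite -ep => lt.
by have := leq_trans lt (leq_trans (subset_leq_card eL) l1).
Qed.

(** The lowest level contains the c chars of one key and a char of a second key that the first one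
    lacks. *)
Lemma level0_card : (1 < #|X|)%N -> (c < #|level 0|)%N.
Proof.
case/card_gt1P => x [y [xX yX ne]].
have [g] := set0Pn _ (delta_neq0 ne).
wlog yg : x y xX yX ne / (y g.1 == g.2) && (x g.1 != g.2).
  move=> W; rewrite inE => h; case: (boolP (y g.1 == g.2)) (h) => yg xg.
    by apply: (W x y) => //; rewrite ?inE // yg; move: xg; case: (x _ == _).
  apply: (W y x) => //; first by rewrite eq_sym.
    by move: xg; rewrite (negPf yg) addbF => ->.
  by rewrite inE addbC.
move=> _; case/andP: yg => yg xg.
have cI : #|[set (i, x i) | i in 'I_c]| = c by rewrite card_imset ?card_ord // => i j [].
have -> : c.+1 = #|g |: [set (i, x i) | i in 'I_c]|.
  rewrite cardsU1 cI; case: imsetP => // -[i _ e].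
  by rewrite e eqxx in xg.
apply/subset_leq_card/subsetP => g'; rewrite !inE => /orP[/eqP ->|/imsetP[i _ ->]].
  by apply/card_gt0P; exists y; rewrite inE yX.
by apply/card_gt0P; exists x; rewrite inE xX /=.
Qed.

Lemma X_gt1 : (0 < d)%N -> X != set0 -> (1 < #|X|)%N.
Proof.
move=> d0 X0; rewrite ltn_neqAle card_gt0 X0 andbT eq_sym; apply/negP => /cards1P[x Xx].
have /eqP[] := X_nonunique (Ordinal d0) (tab_hash T x (Ordinal d0)).
rewrite -(cards1 x); apply: eq_card => y; rewrite Xx !inE.
by case: eqP => // ->; rewrite eqxx.
Qed.


Lemma card_fibers (C : {set char}) : (\sum_i #|fiber C i| = #|C|)%N.
Proof.
transitivity (\sum_i \sum_(a | (i, a) \in C) 1)%N.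
  by apply: eq_bigr => i _; rewrite -sum1_card; apply: eq_bigl => a; rewrite inE.
by rewrite (pair_big_dep xpredT (fun i a => (i, a) \in C) (fun _ _ => 1%N)) -sum1_card /=; apply: eq_bigl => -[].
Qed.

Lemma level_out t : (#|X| <= t)%N -> level t = set0.
Proof.
move=> Xt; apply/setP => g; rewrite !inE; apply/negbTE.
by rewrite -leqNgt (leq_trans (pop_leq g)).
Qed.

Variables (x0 : Phi) (k : nat).
Hypothesis Xk : (#|X| <= k)%N.
Hypothesis X0 : X != set0.
Hypothesis c2 : (1 < c)%N.
Hypothesis d0 : (0 < d)%N.

(** The keys of X, moved to the level by [fill], form the key set required by [candidates]; a
    subsystem of a triangular system is triangular, hence good. *)
Lemma system_witness t (E : {set {set char}}) (D0 D : {set cstr}) g :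
  D \subset system t -> D0 \subset system t -> {in D, forall e : cstr, e.2 \notin E} ->
  (g <= #|D|)%N -> witness x0 k (level t) E D0 g T.
Proof.
move=> Dt D0t DE gD.
have := @pad_set _ set0 D g (sub0set _); rewrite cards0 => /(_ isT gD)[D' [_ D'D D'g]].
have D't := subset_trans D'D Dt.
have UD : D0 :|: D' \subset system t by rewrite subUset D0t.
apply/existsP; exists D'; rewrite -andbA; apply/and3P; split.
- rewrite inE D'g eqxx /=; apply/andP; split.
    apply/subsetP => e eD; have [eL [p [_ _ _ _ ep]]] := systemP (subsetP D't _ eD).
    by rewrite inE in_setT in_setD (DE _ (subsetP D'D _ eD)) ep delta_kdiffs -?ep.
  apply/existsP; exists (fill x0 (level t) @: X); apply/and3P; split.
  + exact: leq_trans (leq_imset_card _ _) Xk.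
  + by apply/subsetP => _ /imsetP[x _ ->]; apply: fill_keys_on.
  + apply/subsetP => e eD; have [eL [p [p1 p2 ne _ ep]]] := systemP (subsetP D't _ eD).
    rewrite inE in_setT ep -(delta_fill x0 (C := level t)) -?ep //.
    apply: delta_diffs; try exact: imset_f.
    apply: contraNneq (delta_neq0 ne) => h.
    rewrite -(delta_fill x0 (C := level t)) -?ep // h.
    by apply/eqP/setP => b; rewrite !inE addbb.
- exact: triangular_good (triangularS UD (system_triangular t)).
- by apply/forall_inP => e /(subsetP UD)/systemP[_ [p []]].
Qed.

(* Levels of at most c chars cannot all just meet the average, since the lowest level
   has more than c chars; this yields the strict inequality for them. *)
Lemma heavy_level_uniform : (forall t, #|level t| = 2%N -> (c * gain t <= d)%N) ->
  exists t, [/\ (2 < #|level t|)%N, (d * #|level t| <= 2 * c * gain t)%N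
    & (#|level t| <= c)%N -> (d * #|level t| < 2 * c * gain t)%N].
Proof.
move=> h2.
have [/existsP[t /and3P[a1 a2 a3]]|no] := boolP [exists t : 'I_#|X|,
  [&& 2 < #|level t|, #|level t| <= c & d * #|level t| < 2 * c * gain t]%N].
  by exists t; split => //; apply: ltnW.
have wE t : weight (fun=> d) (level t) = (d * #|level t|)%N.
  by rewrite /weight -big_distrr /= card_fibers.
have [||t|t ct] := @heavy_level (fun=> d) c (fun t => c < #|level t|)%N _ X0.
- by rewrite sum_nat_const card_ord.
- by apply/level0_card/X_gt1.
- rewrite -leqNgt wE => lc; case: (ltngtP #|level t| 2) => h.
  + by rewrite gain_small ?muln0 // -ltnS.
  + have tX : (t < #|X|)%N by rewrite ltnNge; apply: contraL h => /level_out ->; rewrite cards0.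
    move: no; rewrite negb_exists => /forallP/(_ (Ordinal tX)); rewrite h lc /=; lia.
  + by have := h2 _ h; rewrite h; lia.
rewrite wE => le; exists t; split => //; lia.
Qed.

Definition pair_set (i : 'I_c) (B : {set Phi}) : {set char} := [set (i, a) | a in B].

Lemma kdiffs_pair (P : {set char}) : P \in kdiffs P -> #|P| = 2%N ->
  exists i (B : {set Phi}), #|B| = 2%N /\ P = pair_set i B.
Proof.
rewrite inE => /andP[_ /forallP h] P2.
have /card_gt0P[g gP] : (0 < #|P|)%N by rewrite P2.
have /orP[/eqP e|/eqP f2] := h g.1.
  have : g.2 \in fiber P g.1 by rewrite inE -surjective_pairing.
  by rewrite e inE.
exists g.1, (fiber P g.1); split=> //; apply/esym/eqP; rewrite eqEcard.
rewrite card_imset ?f2 ?P2 ?leqnn ?andbT; last by move=> a b [].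
by apply/subsetP => _ /imsetP[a + ->]; rewrite inE.
Qed.

Lemma fiber_pair_set i B i' : fiber (pair_set i B) i' = if i' == i then B else set0.
Proof.
apply/setP => a; rewrite inE; apply/imsetP/idP => [[b bB [-> ->]]|].
  by rewrite eqxx.
by case: eqP => [->|_]; [exists a|rewrite inE].
Qed.

Variables (smax : nat) (gA : nat -> nat) (gB : nat -> nat -> nat -> nat).
Hypothesis gA_le : forall n G, (2 < n -> d * n <= 2 * c * G ->
  (n <= c -> d * n < 2 * c * G) -> gA n <= G)%N.
Hypothesis gB_le : forall s n p G, (d < c * s -> s <= smax -> p <= n ->
  (c - 1) * s * p + (d - s) * (n - p) <= 2 * (c - 1) * G -> gB s n p <= G)%N.

(** The first and third cases start from a level consisting of one pair with s > d/c equations,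
    where s is above [smax] or not; in the third, C is a larger heavy level without the pair. If
    there is no such pair, uniform weights give the second case. [gA] and [gB] are the numbers of
    equations that averaging guarantees. *)
Lemma nonunique_cases :
  [\/ exists i (B : {set Phi}) (S : {set 'I_d}), [/\ #|B| = 2%N, #|S| = smax.+1 & sats T (setX S [set pair_set i B])],
      exists C : {set char}, [/\ (2 < #|C|)%N, forall i, (#|fiber C i| <= k)%N &
        witness x0 k C [set set0] set0 (gA #|C|) T]
    | exists i (B : {set Phi}) (S : {set 'I_d}) (C : {set char}), [/\ [/\ #|B| = 2%N, (d < c * #|S|)%N & (#|S| <= smax)%N],
        C != set0, [disjoint C & pair_set i B],
        forall i', (#|fiber (C :|: pair_set i B) i'| <= k)%N &
        witness x0 k (C :|: pair_set i B) [set set0; pair_set i B]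
          (setX S [set pair_set i B]) (gB #|S| #|C| #|fiber C i|) T]].
Proof.
have [/existsP[t0 /andP[/eqP P2 lt]]|no] := boolP [exists t : 'I_#|X|,
    (#|level t| == 2%N) && (d < c * gain t)%N]; last first.
  constructor 2; have [t t2|t [a1 a2 a3]] := heavy_level_uniform.
    have tX : (t < #|X|)%N by rewrite ltnNge; apply/negP => /level_out e; rewrite e cards0 in t2.
    move: no; rewrite negb_exists => /forallP/(_ (Ordinal tX)).
    by rewrite /= t2 eqxx /= -leqNgt.
  exists (level t); split=> //; first by move=> i; apply: leq_trans (fiber_level_leq _ _) Xk.
  apply: (@system_witness t _ _ (system t)); rewrite ?sub0set //.
    by have [ne0 _] := system_triangular t; move=> e /ne0; rewrite inE.
  by rewrite card_system gA_le.
set P := level t0 in P2.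
(* A difference has at least two chars, so every equation of the pair level has the whole pair as
   support. *)
have sysP (e : cstr) : e \in system t0 -> e.2 = P.
  move=> /systemP[eP [p [_ _ ne _ ep]]]; apply/eqP.
  by rewrite eqEcard eP P2 ep card_delta.
pose S := [set e.1 | e in system t0].
have sysE : system t0 = setX S [set P].
  apply/setP => -[j Q]; rewrite in_setX in_set1 /=; apply/idP/andP => [h|[/imsetP[e he ->] /eqP ->]].
    by split; [apply/imsetP; exists (j, Q) | rewrite (sysP _ h : Q = P)].
  by rewrite -(sysP _ he) -surjective_pairing.
have Ss : #|S| = gain t0 by rewrite -card_system sysE cardsX cards1 muln1.
have [e0 e0s] : exists e, e \in system t0.
  apply/set0Pn; rewrite -card_gt0 card_system; case: (gain t0) lt => //; lia.
have [i [B [B2 PB]]] : exists i (B : {set Phi}), #|B| = 2%N /\ P = pair_set i B.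
  apply: kdiffs_pair => //; have [eP [p [_ _ ne _ ep]]] := systemP e0s.
  have ePP := sysP _ e0s.
  by rewrite -{1}ePP ep delta_kdiffs // -ep.
rewrite PB in sysE.
have [sl|sl] := ltnP smax #|S|.
  have := @pad_set _ set0 S smax.+1 (sub0set _); rewrite cards0 => /(_ isT sl)[S' [_ S'S S's]].
  constructor 1; exists i, B, S'; split=> //; apply/forall_inP => e eS.
  have /systemP[_ [p []]] // : e \in system t0.
  by rewrite sysE; move: eS; rewrite !inE => /andP[/(subsetP S'S) -> ->].
constructor 3.
have sd : (#|S| <= d)%N by rewrite -[leqRHS]card_ord max_card.
(* With these weights the pair level meets the average exactly: its weight is 2(c-1)s and it carries
   s equations. The heavy level can therefore be sought among the larger levels. *)
pose w (i' : 'I_c) := (if i' == i then (c - 1) * #|S| else d - #|S|)%N.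
have wC (C : {set char}) : (weight w C = (c - 1) * #|S| * #|fiber C i| + (d - #|S|) * (#|C| - #|fiber C i|))%N.
  rewrite /weight -(card_fibers C) (bigD1 i) //= [in RHS](bigD1 i) //= /w eqxx addKn.
  by congr addn; rewrite big_distrr /=; apply: eq_bigr => i' /negPf ->.
have wP : weight w P = (2 * (c - 1) * #|S|)%N.
  by rewrite wC PB fiber_pair_set eqxx B2 -PB P2; lia.
have nested t : (2 < #|level t|)%N -> (t <= t0)%N.
  move=> t2; rewrite leqNgt; apply: contraL t2 => /ltnW/levelS/subset_leq_card.
  by rewrite -/P P2 -leqNgt.
have [||t|t t2 wt] := @heavy_level w (c - 1)%N (fun t => 2 < #|level t|)%N _ X0.
- rewrite (bigD1 i) //= {1}/w eqxx (eq_bigr (fun=> d - #|S|)%N); last by move=> i'; rewrite /w => /negPf ->.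
  rewrite (eq_bigl (fun i' => i' \in predC1 i)) // sum_nat_const cardC1 card_ord -subn1.
  nia.
- by apply: leq_trans (level0_card (X_gt1 _ _)).
- rewrite -leqNgt leq_eqVlt => /orP[/eqP t2|]; last by rewrite ltnS => /gain_small ->; rewrite muln0.
  have lt0 : level t = P.
    apply/eqP; case: (leqP t t0) => [/levelS s|/ltnW/levelS s].
      by rewrite eq_sym eqEcard s t2 P2.
    by rewrite eqEcard s t2 -/P P2.
  by rewrite lt0 wP Ss /gain lt0.
have {}t2 : (2 < #|level t|)%N := t2.
have tt := nested _ t2; have PL : P \subset level t := levelS tt.
have CP : level t :\: P :|: P = level t.
  apply/setP => g; rewrite in_setU in_setD; case: (boolP (g \in P)) => [gP|_] /=; last by rewrite orbF.
  by rewrite (subsetP PL).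
exists i, B, S, (level t :\: P); rewrite -PB CP; split=> //.
- by split=> //; rewrite Ss.
- by rewrite -card_gt0 cardsD (setIidPr PL) P2 subn_gt0.
- by rewrite disjoint_sym disjoints_subset; apply/subsetP => g gP; rewrite in_setC in_setD gP.
- by move=> i'; apply: leq_trans (fiber_level_leq _ _) Xk.
rewrite PB -sysE.
apply: (@system_witness t _ _ (system t :\: system t0)); rewrite ?subsetDl ?systemS //.
(* An equation of the larger level with support P has its pivot in P, so it is already an equation
   of the pair level. *)
- move=> e; rewrite !inE negb_or => /andP[en et].
  have [ne0 _] := system_triangular t; rewrite (ne0 _ et) /=.
  apply: contra en; rewrite -PB => /eqP eP.
  case/imsetP: et eP => -[j g]; rewrite inE /= => /setIP[_ gp] -> /= eP.
  apply/imsetP; exists (j, g); rewrite // inE /= in_setI gp andbT.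
  by have /andP[+ _] := chosen_top gp; rewrite eP.
rewrite cardsD (setIidPr (systemS tt)) !card_system.
have aB a : (a \in B) = ((i, a) \in P).
  by have /setP/(_ a) := fiber_pair_set i B i; rewrite eqxx -PB inE.
have fiberE (A : {set char}) a : (a \in fiber A i) = ((i, a) \in A) by rewrite inE.
have fib : (#|fiber (level t) i| = #|fiber (level t :\: P) i| + 2)%N.
  rewrite -{1}CP -B2 -cardsUI [_ :&: B](_ : _ = set0) ?cards0 ?addn0; last first.
    apply/setP => a; rewrite in_setI in_set0 fiberE in_setD aB.
    by case: (_ \in P); rewrite ?andbF.
  by apply: eq_card => a; rewrite fiberE !in_setU fiberE aB.
have cL : (#|level t| = #|level t :\: P| + 2)%N.
  by rewrite cardsD (setIidPr PL) P2; lia.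
have fC : (#|fiber (level t :\: P) i| <= #|level t :\: P|)%N.
  by rewrite -(card_fibers (level t :\: P)) (bigD1 i) //= leq_addr.
rewrite -PB; apply: gB_le => //; first by rewrite Ss.
(* The pair adds 2(c-1)s to the weight, which pays for the s equations that were removed. *)
move: wt; rewrite wC fib cL -Ss.
set f := #|fiber _ i| in fC *; set n := #|_ :\: P| in fC *.
rewrite (_ : (n + 2 - (f + 2) = n - f)%N); last by lia.
move=> h; rewrite [leqRHS]mulnBr; move: h; rewrite mulnDr (_ : 2 * (c - 1) * #|S| = (c - 1) * #|S| * 2)%N; last by lia.
by move: ((c - 1) * #|S| * 2)%N ((c - 1) * #|S| * f)%N ((d - #|S|) * (n - f))%N (2 * (c - 1) * gain t)%N; lia.
Qed.

End Popularity.

(** * Union bound over the three cases *)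

Section UnionBound.
Variables (R : realFieldType) (Phi : finType) (m c d k : nat).
Variable ps : 'I_c -> {ffun Phi -> Out m d} -> R.
Hypothesis hps : forall i, random_table k (ps i).
Hypothesis hPhi : (k <= #|Phi|)%N.
Hypothesis k2 : (1 < k)%N.
Hypothesis c2 : (1 < c)%N.
Hypothesis d0 : (0 < d)%N.
Notation char := ('I_c * Phi)%type.
Notation q := (#|{: Psi m}|%:R : R).
Variables (x0 : Phi) (smax : nat) (gA : nat -> nat) (gB : nat -> nat -> nat -> nat).
Hypothesis gA_le : forall n G, (2 < n -> d * n <= 2 * c * G ->
  (n <= c -> d * n < 2 * c * G) -> gA n <= G)%N.
Hypothesis gB_le : forall s n p G, (d < c * s -> s <= smax -> p <= n ->
  (c - 1) * s * p + (d - s) * (n - p) <= 2 * (c - 1) * G -> gB s n p <= G)%N.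
Variables (MA : nat -> R) (MB : nat -> nat -> R).
Hypothesis MA_ge0 : forall n, 0 <= MA n.
Hypothesis MB_ge0 : forall s n, 0 <= MB s n.
Hypothesis MA_ge : forall C : {set char}, (2 < #|C|)%N ->
  #|candidates d x0 k C [set set0] (gA #|C|)|%:R * q^-1 ^+ gA #|C| <= MA #|C|.
Hypothesis MB_ge : forall i (B : {set Phi}) s (C : {set char}), #|B| = 2%N ->
  (d < c * s)%N -> (s <= smax)%N -> C != set0 -> [disjoint C & pair_set i B] ->
  #|candidates d x0 k (C :|: pair_set i B) [set set0; pair_set i B] (gB s #|C| #|fiber C i|)|%:R
    * q^-1 ^+ gB s #|C| #|fiber C i| <= MB s #|C|.

Lemma sum_by_card (T : finType) (P : pred {set T}) (F : nat -> R) a b :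
  (forall n, 0 <= F n) -> (forall A : {set T}, P A -> (a <= #|A| < b)%N) ->
  \sum_(A | P A) F #|A| <= \sum_(a <= n < b) 'C(#|T|, n)%:R * F n.
Proof.
move=> F0 Pab.
have -> : \sum_(A | P A) F #|A| = \sum_(A | P A) \sum_(a <= n < b | n == #|A|) F n.
  by apply: eq_bigr => A /Pab h; rewrite big_nat1_eq h.
rewrite (exchange_big_dep xpredT) //=; apply: ler_sum => n _.
rewrite -card_draws sumr_const -[leLHS]mulr_natl ler_wpM2r // ler_nat.
apply/subset_leq_card/subsetP => A; rewrite inE unfold_in => /andP[_ /eqP ->].
by rewrite eqxx.
Qed.

Lemma sum_draws (T : finType) n (x : R) :
  \sum_(A : {set T} | #|A| == n) x = 'C(#|T|, n)%:R * x.
Proof.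
rewrite sumr_const -card_draws -[LHS]mulr_natl; congr (_%:R * _).
by apply: eq_card => A; rewrite inE.
Qed.

Lemma card_char : #|{: char}| = (c * #|Phi|)%N.
Proof. by rewrite card_prod card_ord. Qed.

Lemma card_le_fibers (C : {set char}) :
  (forall i, (#|fiber C i| <= k)%N) -> (#|C| <= c * k)%N.
Proof.
move=> h; rewrite -card_fibers -[c in (c * k)%N]card_ord -sum_nat_const.
exact: leq_sum.
Qed.

Lemma q_inv_ge0 n : 0 <= q^-1 ^+ n.
Proof. by rewrite exprn_ge0 // invr_ge0. Qed.

Lemma Pr_pair i (B : {set Phi}) (S : {set 'I_d}) : #|B| = 2%N ->
  Pr ps (fun T => sats T (setX S [set pair_set i B])) <= q^-1 ^+ #|S|.
Proof.
move=> B2; have -> : #|S| = #|setX S [set pair_set i B]| by rewrite cardsX cards1 muln1.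
apply: (Pr_sats hps hPhi (A := pair_set i B)).
- by move=> i'; rewrite fiber_pair_set; case: eqP; rewrite ?cards0 // B2.
- by move=> e; rewrite inE => /andP[_ /set1P ->].
(* All supports equal the pair and the coordinates differ, so any ranking of the chars will do. *)
apply: (@triangular_good _ _ _ _ (fun g => enum_rank g)); split=> [e|[j P] [j' P']].
  rewrite inE => /andP[_ /set1P ->]; rewrite -card_gt0 card_imset ?B2 //.
  by move=> a b [].
by rewrite !in_setX => /andP[_ /set1P ->] /andP[_ /set1P ->] g /= ->.
Qed.

Definition event_pair (T : Tables Phi m c d) := [exists i, [exists (B : {set Phi} | #|B| == 2%N),
  [exists (S : {set 'I_d} | #|S| == smax.+1), sats T (setX S [set pair_set i B])]]].

Definition event_level (T : Tables Phi m c d) :=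
  [exists (C : {set char} | (2 < #|C|)%N && [forall i, (#|fiber C i| <= k)%N]),
    witness x0 k C [set set0] set0 (gA #|C|) T].

Definition event_pair_level (T : Tables Phi m c d) := [exists i, [exists (B : {set Phi} | #|B| == 2%N),
  [exists (S : {set 'I_d} | (d < c * #|S|)%N && (#|S| <= smax)%N),
  [exists (C : {set char} | [&& C != set0, [disjoint C & pair_set i B] &
       [forall i', (#|fiber (C :|: pair_set i B) i'| <= k)%N]]),
    witness x0 k (C :|: pair_set i B) [set set0; pair_set i B]
          (setX S [set pair_set i B]) (gB #|S| #|C| #|fiber C i|) T]]]].

Lemma not_kunique_events T : ~~ kunique k T ->
  [|| event_pair T, event_level T | event_pair_level T].
Proof.
rewrite /kunique negb_forall => /existsP[X]; rewrite negb_imply -andbA => /and3P[X0 Xk].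
rewrite negb_exists => /forallP Xn.
have Xn' j a : #|[set x in X | tab_hash T x j == a]| != 1%N.
  by have := Xn j; rewrite negb_exists => /forallP/(_ a).
case: (nonunique_cases Xn' x0 Xk X0 c2 d0 gA_le gB_le).
- move=> [i [B [S [B2 Ss h]]]]; apply/or3P; constructor 1.
  apply/existsP; exists i; apply/existsP; exists B; rewrite B2 eqxx /=.
  by apply/existsP; exists S; rewrite Ss eqxx.
- move=> [C [C3 Ck h]]; apply/or3P; constructor 2.
  by apply/existsP; exists C; rewrite C3 h andbT; apply/forallP.
move=> [i [B [S [C [[B2 S1 S2] C0 Cd Ck h]]]]]; apply/or3P; constructor 3.
apply/existsP; exists i; apply/existsP; exists B; rewrite B2 eqxx /=.
apply/existsP; exists S; rewrite S1 S2; apply/existsP; exists C.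
by rewrite C0 Cd h andbT; apply/forallP.
Qed.

Lemma Pr_event_pair :
  Pr ps event_pair <= (c * 'C(#|Phi|, 2) * 'C(d, smax.+1))%:R * q^-1 ^+ smax.+1.
Proof.
rewrite /event_pair; apply: (le_trans (Pr_existsT hps _)).
have -> : (c * 'C(#|Phi|, 2) * 'C(d, smax.+1))%:R * q^-1 ^+ smax.+1 =
    \sum_(i < c) \sum_(B : {set Phi} | #|B| == 2%N)
    \sum_(S : {set 'I_d} | #|S| == smax.+1) q^-1 ^+ smax.+1 :> R.
  by rewrite !sum_draws sumr_const !card_ord -[RHS]mulr_natl !natrM !mulrA.
apply: ler_sum => i _; apply: (le_trans (Pr_exists hps _ _)).
apply: ler_sum => B /eqP B2; apply: (le_trans (Pr_exists hps _ _)).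
by apply: ler_sum => S /eqP Ss; rewrite -Ss Pr_pair.
Qed.

Lemma Pr_event_level :
  Pr ps event_level <= \sum_(3 <= n < (c * k).+1) 'C(c * #|Phi|, n)%:R * MA n.
Proof.
rewrite /event_level; apply: (le_trans (Pr_exists hps _ _)); rewrite -card_char.
apply: (le_trans _ (sum_by_card (P := fun C : {set char} => (2 < #|C|)%N && [forall i, (#|fiber C i| <= k)%N]) MA_ge0 _)).
  apply: ler_sum => C /andP[C2 /forallP Ck]; apply: le_trans (MA_ge C2).
  have := Pr_witness hps hPhi Ck (sub0set (setX setT [set set0])) _ (leqnn #|candidates d x0 k C [set set0] (gA #|C|)|).
  by rewrite cards0 add0n; apply=> e; rewrite inE.
by move=> C /andP[C2 /forallP /card_le_fibers]; rewrite C2 ltnS.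
Qed.

Lemma Pr_event_pair_level : Pr ps event_pair_level <=
  (c * 'C(#|Phi|, 2))%:R * \sum_(0 <= s < smax.+1 | (d < c * s)%N) 'C(d, s)%:R * (q^-1 ^+ s *
     \sum_(1 <= n < (c * k).+1) 'C(c * #|Phi|, n)%:R * MB s n).
Proof.
rewrite /event_pair_level; apply: (le_trans (Pr_existsT hps _)).
set X := \sum_(0 <= s < _ | _) _.
have -> : (c * 'C(#|Phi|, 2))%:R * X = \sum_(i < c) \sum_(B : {set Phi} | #|B| == 2%N) X.
  by rewrite sum_draws sumr_const card_ord -[RHS]mulr_natl natrM mulrA.
apply: ler_sum => i _; apply: (le_trans (Pr_exists hps _ _)).
apply: ler_sum => B /eqP B2; apply: (le_trans (Pr_exists hps _ _)).
pose F s := if (d < c * s)%N then q^-1 ^+ s *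
     \sum_(1 <= n < (c * k).+1) 'C(c * #|Phi|, n)%:R * MB s n else 0.
have -> : X = \sum_(0 <= s < smax.+1) 'C(#|'I_d|, s)%:R * F s.
  rewrite /X big_mkcond; apply: eq_bigr => s _; rewrite /F card_ord.
  by case: ifP; rewrite ?mulr0.
have F0 s : 0 <= F s.
  rewrite /F; case: ifP => // _; rewrite mulr_ge0 ?q_inv_ge0 //.
  by apply: sumr_ge0 => n _; rewrite mulr_ge0 ?MB_ge0.
apply: (le_trans _ (sum_by_card (P := fun S : {set 'I_d} => (d < c * #|S|)%N && (#|S| <= smax)%N) F0 _)); last first.
  by move=> S /andP[_]; rewrite ltnS.
apply: ler_sum => S /andP[S1 S2]; rewrite /F S1.
apply: (le_trans (Pr_exists hps _ _)); rewrite -card_char.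
pose P (C : {set char}) := [&& C != set0, [disjoint C & pair_set i B] &
  [forall i', (#|fiber (C :|: pair_set i B) i'| <= k)%N]].
apply: (@le_trans _ _ (q^-1 ^+ #|S| * \sum_(C | P C) MB #|S| #|C|)); last first.
  rewrite ler_wpM2l ?q_inv_ge0 //; apply: sum_by_card => // C /and3P[C0 _ /forallP Ck].
  rewrite card_gt0 C0 ltnS /=; apply: card_le_fibers => i'.
  by apply: leq_trans (Ck i'); apply/subset_leq_card/fiberS/subsetUl.
rewrite mulr_sumr; apply: ler_sum => C /and3P[C0 Cd /forallP Ck].
apply: le_trans (ler_wpM2l (q_inv_ge0 _) (MB_ge B2 S1 S2 C0 Cd)).
rewrite mulrCA -exprD.
have -> : #|S| = #|setX S [set pair_set i B]| by rewrite cardsX cards1 muln1.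
apply: (Pr_witness hps hPhi Ck) => //.
  by apply/subsetP => e; rewrite !inE => /andP[_ ->]; rewrite orbT.
by move=> e; rewrite inE => /andP[_ /set1P ->]; apply: subsetUr.
Qed.

Theorem prob_not_kunique_le : prob_not_kunique k ps <=
  (c * 'C(#|Phi|, 2) * 'C(d, smax.+1))%:R * q^-1 ^+ smax.+1 +
  (\sum_(3 <= n < (c * k).+1) 'C(c * #|Phi|, n)%:R * MA n +
  (c * 'C(#|Phi|, 2))%:R * \sum_(0 <= s < smax.+1 | (d < c * s)%N) 'C(d, s)%:R * (q^-1 ^+ s *
     \sum_(1 <= n < (c * k).+1) 'C(c * #|Phi|, n)%:R * MB s n)).
Proof.
apply: (le_trans (Pr_le hps (E := fun T => ~~ kunique k T) not_kunique_events)).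
apply: (le_trans (Pr_or hps _ _)); apply: lerD; first exact: Pr_event_pair.
apply: (le_trans (Pr_or hps _ _)); apply: lerD; first exact: Pr_event_level.
exact: Pr_event_pair_level.
Qed.

End UnionBound.

(** * Rounded binary logarithms in units of 1/64 *)

Section Logarithms.
Local Open Scope nat_scope.

(* log_le x l f says 64 log2 x <= l - f. *)
Definition log_le (x l f : nat) := x ^ 64 * 2 ^ f <= 2 ^ l.

Lemma log_le_mul x y l l' f f' :
  log_le x l f -> log_le y l' f' -> log_le (x * y) (l + l') (f + f').
Proof. by rewrite /log_le expnMn !expnD mulnACA => h h'; apply: leq_mul. Qed.

Lemma log_le_mul0 x y l l' : log_le x l 0 -> log_le y l' 0 -> log_le (x * y) (l + l') 0.
Proof. by move=> h h'; have := log_le_mul h h'. Qed.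

Lemma log_le_exp x l f n : log_le x l f -> log_le (x ^ n) (n * l) (n * f).
Proof.
rewrite /log_le => h; elim: n => [|n IH]; first by rewrite !mul0n expn0 exp1n.
by rewrite (expnS x) expnMn !mulSn !expnD mulnACA leq_mul.
Qed.

Lemma log_leW x y l f : x <= y -> log_le y l f -> log_le x l f.
Proof. by rewrite /log_le => xy; apply: leq_trans; rewrite leq_mul2r leq_exp2r ?xy ?orbT. Qed.

(** Division by means of an upper bound for the product and a lower bound h for 64 log2 y; binomial
    coefficients are handled this way, with a factorial as y. *)
Lemma log_le_div x y z l f h : x * y <= z -> log_le z l f -> 2 ^ h <= y ^ 64 -> log_le x l (f + h).
Proof.
move=> xyz /(log_leW xyz); rewrite /log_le expnMn expnD => le hy.
by apply: leq_trans le; rewrite mulnA mulnAC leq_mul2r leq_mul2l hy !orbT.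
Qed.

(** Leaves the logarithmic scale: K is the scaling of probabilities, X the rounded result and G the
    exponent of the power of |Psi|. *)
Lemma log_le_bound x l f K X G : log_le x l f -> l + 64 * K <= 64 * (X + G) + f ->
  x * 2 ^ K <= 2 ^ X * 2 ^ G.
Proof.
rewrite /log_le => h le; rewrite -expnD -(@leq_exp2r _ _ 64) //.
rewrite -(@leq_pmul2r (2 ^ f)) ?expn_gt0 // expnMn mulnAC.
rewrite -!expnM [X in _ <= X]mulnC.
apply: (@leq_trans (2 ^ l * 2 ^ (K * 64))); first by rewrite leq_mul2r h orbT.
by rewrite -!expnD leq_exp2l // addnC [K * _]mulnC [_ * 64]mulnC [f + _]addnC addnC.
Qed.

Lemma expn_pow a b : Nat.pow a b = a ^ b.
Proof. by elim: b => //= b ->; rewrite expnS. Qed.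

Lemma to_natD x y : N.to_nat (x + y)%num = N.to_nat x + N.to_nat y.
Proof. exact: N2Nat.inj_add. Qed.

Lemma to_natM x y : N.to_nat (x * y)%num = N.to_nat x * N.to_nat y.
Proof. exact: N2Nat.inj_mul. Qed.

Lemma to_nat_exp2 n : N.to_nat (2 ^ n)%num = 2 ^ N.to_nat n.
Proof. by rewrite N2Nat.inj_pow expn_pow. Qed.

(** Floating-point numbers: a mantissa and a binary exponent. *)
Definition float_val (p : N * N) := N.to_nat p.1 * 2 ^ N.to_nat p.2.

(** Keeps the 12 leading bits; adding 1 to a truncated mantissa makes the rounding go upward. *)
Definition round_up (x : N) : N * N :=
  let s := (N.size x - 12)%num in
  if (s =? 0)%num then (x, 0%num) else ((N.shiftr x s + 1)%num, s).

Definition round_down (x : N) : N * N :=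
  let s := (N.size x - 12)%num in (N.shiftr x s, s).

Lemma round_upP x : N.to_nat x <= float_val (round_up x).
Proof.
rewrite /round_up /float_val; case: N.eqb => /=; first by rewrite expn0 muln1.
rewrite -to_nat_exp2; set s := (N.size x - 12)%num; rewrite N.shiftr_div_pow2.
have p0 : (2 ^ s <> 0)%num by apply: N.pow_nonzero.
have := N.div_mod x _ p0; have := N.mod_lt x _ p0.
move: (2 ^ s)%num (x / 2 ^ s)%num (x mod 2 ^ s)%num => p y r; nia.
Qed.

Lemma round_downP x : float_val (round_down x) <= N.to_nat x.
Proof.
rewrite /round_down /float_val /= -to_nat_exp2.
set s := (N.size x - 12)%num; rewrite N.shiftr_div_pow2.
have p0 : (2 ^ s <> 0)%num by apply: N.pow_nonzero.
have := N.div_mod x _ p0.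
move: (2 ^ s)%num (x / 2 ^ s)%num (x mod 2 ^ s)%num => p y r; nia.
Qed.

Definition square (rnd : N -> N * N) (p : N * N) : N * N :=
  let q := rnd (p.1 * p.1)%num in (q.1, (q.2 + 2 * p.2)%num).

Lemma float_val_square rnd p : float_val (square rnd p) =
  float_val (rnd (p.1 * p.1)%num) * 2 ^ (2 * N.to_nat p.2).
Proof.
rewrite /float_val (_ : (square rnd p).2 = ((rnd (p.1 * p.1)%num).2 + 2 * p.2)%num) //.
by rewrite to_natD to_natM expnD mulnA.
Qed.

Lemma square_up v p : v <= float_val p -> v ^ 2 <= float_val (square round_up p).
Proof.
move=> h; rewrite float_val_square.
apply: (@leq_trans (float_val p ^ 2)); first by rewrite leq_exp2r.
rewrite /float_val expnMn -expnM [_ * 2]mulnC leq_mul2r -mulnn; apply/orP; right.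
by have := round_upP (p.1 * p.1)%num; rewrite to_natM.
Qed.

Lemma square_down v p : float_val p <= v -> float_val (square round_down p) <= v ^ 2.
Proof.
move=> h; rewrite float_val_square.
apply: (@leq_trans (float_val p ^ 2)); last by rewrite leq_exp2r.
rewrite /float_val expnMn -expnM [_ * 2]mulnC leq_mul2r -mulnn; apply/orP; right.
by have := round_downP (p.1 * p.1)%num; rewrite to_natM.
Qed.

(** Six squarings produce the 64th power, whose bit length bounds 64 log2 x. *)
Definition log_up (x : N) : N :=
  let p := iter 6 (square round_up) (round_up x) in (N.log2 p.1 + 1 + p.2)%num.

Definition log_down (x : N) : N :=
  let p := iter 6 (square round_down) (round_down x) in
  if (p.1 =? 0)%num then 0%num else (N.log2 p.1 + p.2)%num.

Lemma exp64 v : v ^ 64 = ((((((v ^ 2) ^ 2) ^ 2) ^ 2) ^ 2) ^ 2).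
Proof. by rewrite -!expnM. Qed.

Lemma log_upP x : log_le (N.to_nat x) (N.to_nat (log_up x)) 0.
Proof.
rewrite /log_le expn0 muln1 /log_up; set p := iter _ _ _.
have : N.to_nat x ^ 64 <= float_val p.
  by rewrite exp64; do 6!apply: square_up; apply: round_upP.
move/leq_trans; apply; rewrite /float_val to_natD expnD leq_mul2r -to_nat_exp2.
apply/orP; right; case: (N.eq_dec p.1 0) => [->//|p0].
have := N.log2_spec p.1; rewrite N.add_1_r; lia.
Qed.

Lemma log_downP x : (0 < x)%num -> 2 ^ N.to_nat (log_down x) <= N.to_nat x ^ 64.
Proof.
move=> x0; rewrite /log_down; set p := iter _ _ _.
have le : float_val p <= N.to_nat x ^ 64.
  by rewrite exp64; do 6!apply: square_down; apply: round_downP.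
case: N.eqb_spec => [_|p0]; first by rewrite expn_gt0; lia.
apply: leq_trans le; rewrite /float_val to_natD expnD leq_mul2r -to_nat_exp2.
by apply/orP; right; have := N.log2_spec p.1; lia.
Qed.

(** Started from 0 with accumulator 0, entry j adds the lower logarithms of 1 to j and so bounds 64
    log2 of j! from below. *)
Fixpoint fact_logs (n : nat) (i acc : N) : seq N :=
  acc :: if n is n'.+1 then fact_logs n' (i + 1)%num (acc + log_down (i + 1))%num else [::].

Lemma fact_logsP n i acc j : 2 ^ N.to_nat acc <= (N.to_nat i)`! ^ 64 -> j <= n ->
  2 ^ N.to_nat (nth 0%num (fact_logs n i acc) j) <= (N.to_nat i + j)`! ^ 64.
Proof.
elim: n i acc j => [|n IH] i acc [|j] //= h jn; rewrite ?addn0 //.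
have -> : N.to_nat i + j.+1 = N.to_nat (i + 1)%num + j by lia.
apply: IH => //; rewrite to_natD expnD.
have -> : N.to_nat (i + 1)%num = (N.to_nat i).+1 by lia.
rewrite factS mulnC expnMn leq_mul //.
by apply: (leq_trans (log_downP _)); rewrite ?leq_exp2r //; lia.
Qed.

Lemma fact_exp_leq n e : n`! * n ^ e <= (n + e)`!.
Proof.
elim: e => [|e IH]; first by rewrite expn0 muln1 addn0.
rewrite expnS mulnCA addnS factS; apply: leq_mul => //; lia.
Qed.

(** Beyond the table, n! is bounded below by n0! times n0^(n - n0). *)
Definition fact_log (n0 : N) (tab : seq N) (n : N) : N :=
  if (n <=? n0)%num then nth 0%num tab (N.to_nat n)
  else (nth 0%num tab (N.to_nat n0) + (n - n0) * log_down n0)%num.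

Lemma fact_logP n0 n : (0 < n0)%num ->
  2 ^ N.to_nat (fact_log n0 (fact_logs (N.to_nat n0) 0 0) n) <= (N.to_nat n)`! ^ 64.
Proof.
move=> n0_gt0.
have base : 2 ^ N.to_nat 0%num <= (N.to_nat 0%num)`! ^ 64 by [].
rewrite /fact_log; case: N.leb_spec => h.
  by have := @fact_logsP (N.to_nat n0) _ _ (N.to_nat n) base; rewrite add0n; apply; lia.
rewrite to_natD to_natM expnD.
have hn0 := fact_logsP base (leqnn (N.to_nat n0)); rewrite add0n in hn0.
have -> : N.to_nat n = N.to_nat n0 + N.to_nat (n - n0)%num by lia.
apply: leq_trans (_ : ((N.to_nat n0)`! * N.to_nat n0 ^ N.to_nat (n - n0)%num) ^ 64 <= _); last first.
  by rewrite leq_exp2r // fact_exp_leq.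
rewrite expnMn; apply: leq_mul; first exact: hn0.
rewrite -[leqRHS]expnM [_ * 64]mulnC [leqRHS]expnM [_ * N.to_nat (log_down n0)]mulnC [leqLHS]expnM.
by case: (N.to_nat (n - n0)) => [|e] //; rewrite leq_exp2r // log_downP.
Qed.

End Logarithms.

(** * Maximal products under a fixed sum *)

Section ProductBounds.
Local Open Scope nat_scope.

Lemma AGM_nat (I : finType) (A : {set I}) (f : I -> nat) :
  (\prod_(i in A) f i) * #|A| ^ #|A| <= (\sum_(i in A) f i) ^ #|A|.
Proof.
have /leif_AGM_scaled[+ _] : {in A, forall i, (0 <= ((f i)%:R : int) *+ #|A|)%R}.
  by move=> i _; rewrite mulrn_wge0.
rewrite (eq_bigr (fun i => (f i)%:R * (#|A|%:R : int))%R); last by move=> i _; rewrite mulr_natr.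
by rewrite big_split /= -natr_prod prodr_const -natr_sum -!natrX -natrM ler_nat.
Qed.

(** The finitely many cases are checked at k = 10, and a larger k only increases the right side. *)
Lemma exp_self_leq r n k : r <= n -> n <= 4 -> 10 <= k -> n ^ n <= r ^ r * k ^ (n - r).
Proof.
move=> rn n4 k10; apply: (@leq_trans (r ^ r * 10 ^ (n - r))); last first.
  by rewrite leq_mul2l; apply/orP; right; case: (n - r) => // e; rewrite leq_exp2r.
by move: n r rn n4 => [|[|[|[|[|]]]]] [|[|[|[|[|]]]]] //= _ _; vm_compute.
Qed.

(* If only r < n of the f i are nonzero, AM-GM bounds the product by (k / r)^r, which is
   at most (k / n)^n once the sum k is at least 10. *)
Lemma prod_max1_leq (I : finType) (A : {set I}) (f : I -> nat) :
  #|A| <= 4 -> 10 <= \sum_(i in A) f i ->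
  (\prod_(i in A) maxn (f i) 1) * #|A| ^ #|A| <= (\sum_(i in A) f i) ^ #|A|.
Proof.
move=> A4 k10; pose B := [set i in A | 0 < f i].
have BA : B \subset A by apply/subsetP => i; rewrite inE => /andP[].
have -> : \prod_(i in A) maxn (f i) 1 = \prod_(i in B) f i.
  rewrite (big_setID B) /= (setIidPr BA) [X in _ * X]big1 ?muln1.
    by apply: eq_bigr => i; rewrite inE => /andP[_ h]; rewrite (maxn_idPl _).
  by move=> i; rewrite !inE => /andP[+ iA]; rewrite iA /= -eqn0Ngt => /eqP ->.
have sB : \sum_(i in A) f i = \sum_(i in B) f i.
  rewrite (big_setID B) /= (setIidPr BA) [X in _ + X]big1 ?addn0 // => i.
  by rewrite !inE => /andP[+ iA]; rewrite iA /= -eqn0Ngt => /eqP ->.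
have le := subset_leq_card BA; have := exp_self_leq le A4 k10.
move=> h; rewrite -[X in _ <= _ ^ X](subnKC le) expnD.
apply: (@leq_trans ((\prod_(i in B) f i) * (#|B| ^ #|B| * (\sum_(i in A) f i) ^ (#|A| - #|B|)))).
  by rewrite leq_mul2l h orbT.
by rewrite mulnA leq_mul2r {2}sB AGM_nat orbT.
Qed.

Lemma bin_mul_fact_leq n k : 'C(n, k) * k`! <= n ^ k.
Proof.
rewrite bin_ffact; elim: k => [|k IH]; first by rewrite ffactn0 expn0.
by rewrite ffactnSr expnSr leq_mul ?leq_subr.
Qed.

Definition pairs1 (a : nat) := 1 + 'C(a, 2).

Fixpoint pairs1_table (n : nat) (i acc : N) : seq N :=
  acc :: if n is n'.+1 then pairs1_table n' (i + 1)%num (acc + i)%num else [::].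

Lemma size_pairs1_table n i acc : size (pairs1_table n i acc) = n.+1.
Proof. by elim: n i acc => //= n IH i acc; rewrite IH. Qed.

Lemma pairs1_tableP n i acc j : N.to_nat acc = pairs1 (N.to_nat i) -> j <= n ->
  N.to_nat (nth 0%num (pairs1_table n i acc) j) = pairs1 (N.to_nat i + j).
Proof.
elim: n i acc j => [|n IH] i acc [|j] //= h jn; rewrite ?addn0 //.
have -> : N.to_nat i + j.+1 = N.to_nat (i + 1)%num + j by lia.
apply: IH => //; rewrite !to_natD h addn1 /pairs1 binS bin1; lia.
Qed.

Fixpoint dot_max (xs ys : seq N) : N :=
  if xs is x :: xs' then if ys is y :: ys' then N.max (x * y) (dot_max xs' ys') else 0%num
  else 0%num.

(** Convolution with maximum in place of sum: [pre] holds the part of [xs] already read, in reverse,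
    so entry k is the largest product of an entry of [xs] and an entry of [ys] whose indices add up
    to k. *)
Fixpoint conv_max (pre xs ys : seq N) : seq N :=
  if xs is x :: xs' then dot_max (x :: pre) ys :: conv_max (x :: pre) xs' ys else [::].

Lemma dot_maxP xs ys i : i < size xs -> i < size ys ->
  N.to_nat (nth 0%num xs i) * N.to_nat (nth 0%num ys i) <= N.to_nat (dot_max xs ys).
Proof.
elim: xs ys i => // x xs IH [|y ys] [|i] //= h1 h2.
  rewrite -to_natM; lia.
by apply: (leq_trans (IH ys i h1 h2)); lia.
Qed.

Lemma size_conv_max pre xs ys : size (conv_max pre xs ys) = size xs.
Proof. by elim: xs pre => //= x xs IH pre; rewrite IH. Qed.

Lemma nth_conv_max pre xs ys k : k < size xs ->
  nth 0%num (conv_max pre xs ys) k = dot_max (rev (take k.+1 xs) ++ pre) ys.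
Proof.
elim: xs pre k => // x xs IH pre [|k] //= h; first by rewrite take0.
by rewrite IH // [in RHS]rev_cons cat_rcons.
Qed.

Lemma conv_maxP xs ys a b : a + b < size xs -> b < size ys ->
  N.to_nat (nth 0%num xs a) * N.to_nat (nth 0%num ys b) <=
  N.to_nat (nth 0%num (conv_max [::] xs ys) (a + b)).
Proof.
move=> h1 h2; rewrite nth_conv_max // cats0.
have := @dot_maxP (rev (take (a + b).+1 xs)) ys b.
rewrite size_rev size_takel // nth_rev ?size_takel //; last by lia.
rewrite nth_take; last by lia.
rewrite (_ : (a + b).+1 - b.+1 = a); last by lia.
by apply=> //; lia.
Qed.

(* Entry k of [vector_table n j] bounds the number of difference vectors on a set of
   k chars spread over j + 1 positions. *)
Definition vector_table (n j : nat) : seq N :=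
  let W := pairs1_table n 0 1 in iter j (fun xs => conv_max [::] xs W) W.

Lemma size_vector_table n j : size (vector_table n j) = n.+1.
Proof. by rewrite /vector_table; elim: j => /= [|j IH]; rewrite ?size_conv_max ?IH // size_pairs1_table. Qed.

Lemma vector_table_seq n j (s : seq nat) : size s = j.+1 -> sumn s <= n ->
  \prod_(a <- s) pairs1 a <= N.to_nat (nth 0%num (vector_table n j) (sumn s)).
Proof.
have base : N.to_nat 1%num = pairs1 (N.to_nat 0%num) by [].
elim: j s => [|j IH] [|a s] //= [ss] sn.
  case: s ss sn => // _; rewrite /= addn0 => an.
  by rewrite big_seq1 /vector_table /= (pairs1_tableP base an).
rewrite big_cons /=; rewrite addnC in sn *.
apply: leq_trans (_ : _ <= N.to_nat (nth 0%num (vector_table n j) (sumn s)) * N.to_nat (nth 0%num (pairs1_table n 0 1) a)) _.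
  rewrite mulnC leq_mul ?IH //; first by lia.
  by rewrite (pairs1_tableP base) //; lia.
by apply: conv_maxP; rewrite ?size_vector_table ?size_pairs1_table; lia.
Qed.

Lemma vector_tableP (I : finType) (A : {set I}) (f : I -> nat) n j :
  #|A| = j.+1 -> \sum_(i in A) f i <= n ->
  \prod_(i in A) pairs1 (f i) <= N.to_nat (nth 0%num (vector_table n j) (\sum_(i in A) f i)).
Proof.
move=> Aj; have := @vector_table_seq n j [seq f i | i <- enum A].
rewrite size_map -cardE Aj sumnE !big_map !big_enum /=.
exact.
Qed.

End ProductBounds.

(** * Evaluation of the single terms of the union bound *)

Section Certificate.
Local Open Scope nat_scope.
Variables (c d a m smax P lo hi r : nat) (K : N).
Notation nat2N := N.of_nat.

(** The least g with d n <= 2 c g, where the inequality is strict for n <= c as in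
    [heavy_level_uniform]. *)
Definition gain_level (n : N) : N :=
  (let h := 2 * nat2N c in
   if n <=? nat2N c then (nat2N d * n) / h + 1 else (nat2N d * n + (h - 1)) / h)%num.

Definition gain_pair (s n p : N) : N :=
  (let h := 2 * (nat2N c - 1) in
   ((nat2N d - s) * (n - p) + (nat2N c - 1) * s * p + (h - 1)) / h)%num.

(* For n in [lo, hi], the fibers of size p < P over the position of the popular pair are
   treated separately; a fiber of size at least [classes n] is treated as one of that size. *)
Definition classes (n : nat) := if lo <= n <= hi then P else 0.

Definition min_gain_level (n : nat) := N.to_nat (gain_level (nat2N n)).

Definition min_gain_pair (s n p : nat) :=
  N.to_nat (gain_pair (nat2N s) (nat2N n) (nat2N (minn p (classes n)))).

Lemma min_gain_levelP n G : 1 < c -> d * n <= 2 * c * G -> (n <= c -> d * n < 2 * c * G) ->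
  min_gain_level n <= G.
Proof.
move=> c2 le lt; rewrite /min_gain_level /gain_level.
have h0 : (2 * nat2N c <> 0)%num by lia.
case: N.leb_spec => nc.
  have {}lt : d * n < 2 * c * G by apply: lt; lia.
  have := @N.div_lt_upper_bound (nat2N d * nat2N n) (2 * nat2N c) (nat2N G) h0.
  by move: (_ / _)%num => x h; have : (x < nat2N G)%num by [apply: h; nia]; lia.
have := @N.div_lt_upper_bound (nat2N d * nat2N n + (2 * nat2N c - 1)) (2 * nat2N c) (nat2N G + 1) h0.
by move: (_ / _)%num => x h; have : (x < nat2N G + 1)%num by [apply: h; nia]; lia.
Qed.

(** Lowering p to p' only weakens the inequality: d < c s gives d - s <= (c-1)s, so chars over the
    position of the pair weigh at least as much as the others. *)
Lemma min_gain_pairP s n p G : 1 < c -> d < c * s -> p <= n ->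
  (c - 1) * s * p + (d - s) * (n - p) <= 2 * (c - 1) * G -> min_gain_pair s n p <= G.
Proof.
move=> c2 ds pn le; rewrite /min_gain_pair /gain_pair; set p' := minn _ _.
have p'p : p' <= p by rewrite geq_minl.
have le' : (c - 1) * s * p' + (d - s) * (n - p') <= 2 * (c - 1) * G.
  apply: leq_trans le; have -> : n - p' = (n - p) + (p - p') by lia.
  have e : (c - 1) * s * p = (c - 1) * s * p' + (c - 1) * s * (p - p') by rewrite -mulnDr subnKC.
  rewrite e mulnDr.
  have : (d - s) * (p - p') <= (c - 1) * s * (p - p').
    by rewrite leq_mul2r; apply/orP; right; rewrite mulnBl mul1n leq_sub2r // ltnW.
  lia.
have h0 : (2 * (nat2N c - 1) <> 0)%num by lia.
have := @N.div_lt_upper_bound ((nat2N d - nat2N s) * (nat2N n - nat2N p') +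
  (nat2N c - 1) * nat2N s * nat2N p' + (2 * (nat2N c - 1) - 1)) (2 * (nat2N c - 1)) (nat2N G + 1) h0.
have -> : (nat2N d - nat2N s = nat2N (d - s))%num by lia.
have -> : (nat2N n - nat2N p' = nat2N (n - p'))%num by lia.
have -> : (nat2N c - 1 = nat2N (c - 1))%num by lia.
by move: (_ / _)%num => x h; have : (x < nat2N G + 1)%num by [apply: h; nia]; lia.
Qed.

Variables (V V1 W tab : seq N).
Hypothesis V_eq : V = vector_table r (c - 1).
Hypothesis V1_eq : V1 = vector_table r (c - 2).
Hypothesis W_eq : W = vector_table r 0.
Hypothesis tab_eq : tab = fact_logs 200 0 0.

Notation fl := (fact_log 200 tab).

(** The value K + (l - f)/64 - m g rounded up; shifting by 6 bits divides by 64. Truncated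
    subtraction yields 0 for tiny terms, which then count as 2^(-K). *)
Definition exponent (l f g : N) : N :=
  N.shiftr (64 * K + l + 63 - (64 * (nat2N m * g) + f)) 6.

Lemma exponentP x l f g : log_le x (N.to_nat l) (N.to_nat f) ->
  x * 2 ^ N.to_nat K <= 2 ^ N.to_nat (exponent l f g) * 2 ^ (m * N.to_nat g).
Proof.
move=> h; apply: (log_le_bound h); rewrite /exponent N.shiftr_div_pow2.
have -> : m * N.to_nat g = N.to_nat (nat2N m * g) by rewrite to_natM Nat2N.id.
change (2 ^ 6)%num with 64%num.
set x0 := (_ + 63 - _)%num.
have h1 := N.div_mod x0 64; have h2 := N.mod_lt x0 64.
by move: (x0 / 64)%num (x0 mod 64)%num h1 h2; rewrite /x0; move: (nat2N m * g)%num => C A B; lia.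
Qed.

(* [vv] and [kv] tell whether the count of vectors, resp. of key sets, may be used. *)
Definition cost (vv kv : bool) (L F M c' k mul g G : N) : N :=
  let xv := exponent (L + g * log_up M)%num (F + fl g)%num G in
  let xk := exponent (L + (100 * (log_up mul + c' * log_up k) + g * log_up (4950 * nat2N d)))%num
     (F + (100 * (c' * log_down c') + fl 100 + fl g))%num G in
  if vv then if kv then N.min xv xk else xv else xk.

Lemma fact_log_tab n : 2 ^ N.to_nat (fl n) <= (N.to_nat n)`! ^ 64.
Proof. by rewrite tab_eq; apply: (@fact_logP 200). Qed.

Lemma log_le_bin M n x : x <= N.to_nat M ->
  log_le 'C(x, N.to_nat n) (N.to_nat (n * log_up M)) (N.to_nat (fl n)).
Proof.
move=> xM; rewrite to_natM -[N.to_nat (fl n)]add0n.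
apply: (log_le_div (z := N.to_nat M ^ N.to_nat n)) (fact_log_tab n).
  apply: (leq_trans (bin_mul_fact_leq _ _)).
  by case: (N.to_nat n) => [|e]; rewrite ?expn0 ?leq_exp2r.
by have := log_le_exp (N.to_nat n) (log_upP M); rewrite muln0.
Qed.

Lemma bin_100_2 : 'C(100, 2) = N.to_nat 4950.
Proof. by rewrite bin2. Qed.

(** In the count by keys, N0 bounds the number of keys on C, and its last condition is the AM-GM
    estimate N0 <= mul (k / c')^c' cleared of denominators. The number 4950 counts the pairs among
    100 keys. *)
Lemma costP X cnt L F (vv kv : bool) M c' k mul g G :
  log_le X (N.to_nat L) (N.to_nat F) ->
  (vv -> cnt <= 'C(N.to_nat M, N.to_nat g)) ->
  (kv -> exists2 N0, cnt <= 'C(N0, 100) * 'C(d * 'C(100, 2), N.to_nat g) &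
     N0 * N.to_nat c' ^ N.to_nat c' <= N.to_nat mul * N.to_nat k ^ N.to_nat c') ->
  (0 < c')%num -> vv || kv ->
  X * cnt * 2 ^ N.to_nat K <=
    2 ^ N.to_nat (cost vv kv L F M c' k mul g G) * 2 ^ (m * N.to_nat G).
Proof.
move=> hX hv hk c'0 vk; rewrite /cost.
set xv := exponent _ _ _; set xk := exponent _ _ _.
have Hv : vv -> X * cnt * 2 ^ N.to_nat K <= 2 ^ N.to_nat xv * 2 ^ (m * N.to_nat G).
  move=> /hv le; apply: exponentP; rewrite !to_natD; apply: log_le_mul => //.
  exact: log_leW le (log_le_bin _ (leqnn _)).
have Hk : kv -> X * cnt * 2 ^ N.to_nat K <= 2 ^ N.to_nat xk * 2 ^ (m * N.to_nat G).
  move=> /hk[N0 le hN]; apply: exponentP; rewrite !to_natD; apply: log_le_mul => //.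
  apply: (log_leW le); apply: log_le_mul; last first.
    by apply: log_le_bin; rewrite to_natM Nat2N.id bin_100_2 mulnC.
  have hN0 : log_le N0 (N.to_nat (log_up mul + c' * log_up k)) (N.to_nat (c' * log_down c')).
    rewrite -[N.to_nat (_ * log_down _)]add0n; apply: (log_le_div hN).
      rewrite to_natD; apply: log_le_mul0; first exact: log_upP.
      by rewrite to_natM; have := log_le_exp (N.to_nat c') (log_upP k); rewrite muln0.
    rewrite to_natM mulnC [leqLHS]expnM -[leqRHS]expnM [_ * 64]mulnC [leqRHS]expnM.
    by case: (N.to_nat c') (log_downP c'0) => // e h; rewrite leq_exp2r.
  have hp : log_le (N0 ^ 100) (N.to_nat (100 * (log_up mul + c' * log_up k)))
      (N.to_nat (100 * (c' * log_down c'))).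
    by rewrite !(to_natM 100); apply: (log_le_exp 100 hN0).
  have hf : 2 ^ N.to_nat (fl 100) <= 100`! ^ 64 := fact_log_tab 100.
  exact: (log_le_div (bin_mul_fact_leq N0 100) hp hf).
case: vv hv vk Hv => [_ _ /(_ isT) Hv|_ /= kv1 _]; last by rewrite kv1 in Hk *; apply: Hk.
case: kv hk Hk => [_ /(_ isT) Hk|_ _ //].
by case: (N.min_spec xv xk) => -[_ ->].
Qed.

(** The first condition serves [prod_max1_leq]; the second makes the AM-GM estimate at least 100, as
    [card_candidates_keys] demands. *)
Definition key_count_valid (c' k mul : N) : bool :=
  ((10 <=? k) && (100 * c' ^ c' <=? mul * k ^ c'))%num.

Lemma key_count_validP c' k mul :
  reflect (10 <= N.to_nat k /\
      100 * N.to_nat c' ^ N.to_nat c' <= N.to_nat mul * N.to_nat k ^ N.to_nat c')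
    (key_count_valid c' k mul).
Proof.
have E : N.to_nat (100 * c' ^ c') = 100 * N.to_nat c' ^ N.to_nat c'.
  by rewrite to_natM N2Nat.inj_pow expn_pow.
have E' : N.to_nat (mul * k ^ c') = N.to_nat mul * N.to_nat k ^ N.to_nat c'.
  by rewrite to_natM N2Nat.inj_pow expn_pow.
rewrite -E -E' /key_count_valid.
move: (100 * c' ^ c')%num (mul * k ^ c')%num => x y.
by apply: (iffP andP) => -[h1 h2]; split; move: h1 h2; rewrite /is_true !N.leb_le; lia.
Qed.

(** Logarithm of (c 2^a)^n, which over n! bounds the number of sets of n chars. *)
Definition prefactor (n : N) : N := (n * (64 * nat2N a + log_up (nat2N c)))%num.

Lemma log_le_prefactor n :
  log_le 'C(c * 2 ^ a, n) (N.to_nat (prefactor (nat2N n))) (N.to_nat (fl (nat2N n))).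
Proof.
rewrite /prefactor to_natM Nat2N.id -[N.to_nat (fl _)]add0n.
have h := fact_log_tab (nat2N n); rewrite Nat2N.id in h.
apply: (log_le_div (bin_mul_fact_leq _ _) _ h).
have := @log_le_exp (c * 2 ^ a) (N.to_nat (64 * nat2N a + log_up (nat2N c))) 0 n.
rewrite muln0; apply; rewrite mulnC to_natD; apply: log_le_mul0.
  by rewrite /log_le expn0 muln1 to_natM Nat2N.id (_ : N.to_nat 64 = 64) // -expnM [a * _]mulnC leqnn.
by have := log_upP (nat2N c); rewrite Nat2N.id.
Qed.

Definition exponent_level (n : nat) : N :=
  let g := gain_level (nat2N n) in
  cost (n <= r) (key_count_valid (nat2N c) (nat2N n) 1) (prefactor (nat2N n)) (fl (nat2N n))
    (nat2N d * (nth 0 V n - 1))%num (nat2N c) (nat2N n) 1 g g.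

(** Logarithm of c 2^(2a - 1), a bound for the number of pairs of chars sharing a position. *)
Definition log_pair : N := (log_up (nat2N c) + 64 * (2 * nat2N a - 1))%num.

Fixpoint log_ffact (x : nat) (s : nat) : N :=
  if s is s'.+1 then (log_up (nat2N x) + log_ffact x.-1 s')%num else 0%num.

Lemma log_le_ffact x s : log_le (x ^_ s) (N.to_nat (log_ffact x s)) 0.
Proof.
elim: s x => [|s IH] x; first by rewrite /log_le ffactn0 exp1n.
have -> : log_ffact x s.+1 = (log_up (nat2N x) + log_ffact x.-1 s)%num by [].
rewrite ffactnS to_natD; apply: log_le_mul0; last exact: IH.
by have := log_upP (nat2N x); rewrite Nat2N.id.
Qed.

Lemma log_le_pair s : 0 < a ->
  log_le (c * 'C(2 ^ a, 2) * 'C(d, s)) (N.to_nat (log_pair + log_ffact d s))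
    (N.to_nat (fl (nat2N s))).
Proof.
move=> a0; rewrite to_natD -[N.to_nat (fl _)]add0n; apply: log_le_mul; last first.
  have h := fact_log_tab (nat2N s); rewrite Nat2N.id in h.
  rewrite -[N.to_nat (fl _)]add0n; apply: (log_le_div _ (log_le_ffact d s) h).
  by rewrite bin_ffact.
rewrite to_natD; apply: log_le_mul0.
  by have := log_upP (nat2N c); rewrite Nat2N.id.
apply: (@log_leW _ (2 ^ (2 * a - 1))).
  rewrite -(@leq_pmul2r 2) // -expnSr (_ : (2 * a - 1).+1 = a * 2); last by lia.
  by rewrite expnM; have := bin_mul_fact_leq (2 ^ a) 2.
by rewrite /log_le expn0 muln1 -expnM leq_exp2l //; lia.
Qed.

Definition exponent_pair : N :=
  exponent (log_pair + log_ffact d smax.+1)%num (fl (nat2N smax.+1)) (nat2N smax.+1).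

(** Below [classes n] the position of the pair has exactly p + 2 chars and its factor is split off;
    the last class uses only the total n + 2. The subtracted 2 stands for the excluded supports, the
    empty set and the pair. *)
Definition exponent_class (s n p : nat) : N :=
  let g := gain_pair (nat2N s) (nat2N n) (nat2N p) in
  let L := (log_pair + log_ffact d s + prefactor (nat2N n))%num in
  let F := (fl (nat2N s) + fl (nat2N n))%num in
  let G := (nat2N s + g)%num in
  if p < classes n then
    cost true (key_count_valid (nat2N c - 1) (nat2N n - nat2N p) (nat2N p + 2)) L F
      (nat2N d * (nth 0 W (p + 2) * nth 0 V1 (n - p) - 2))%num
      (nat2N c - 1) (nat2N n - nat2N p) (nat2N p + 2) g G
  else
    cost (n + 2 <= r) (key_count_valid (nat2N c) (nat2N n + 2) 1) L F
      (nat2N d * (nth 0 V (n + 2) - 2))%num (nat2N c) (nat2N n + 2) 1 g G.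

Fixpoint max_upto (f : nat -> N) (p : nat) : N :=
  if p is p'.+1 then N.max (f p) (max_upto f p') else f 0.

Lemma max_uptoP f p i : i <= p -> N.to_nat (f i) <= N.to_nat (max_upto f p).
Proof.
elim: p => [|p IH] /=; first by rewrite leqn0 => /eqP ->.
by rewrite leq_eqVlt => /orP[/eqP -> |]; [lia | rewrite ltnS => /IH; lia].
Qed.

(** The union bound distinguishes the sets C by size only, so the worst class is taken. *)
Definition exponent_pair_level (s n : nat) : N := max_upto (exponent_class s n) (classes n).

Section Sound.
Variables (Phi : finType) (x0 : Phi).
Hypothesis c2 : 1 < c.
Hypothesis c4 : c <= 4.
Hypothesis a0 : 0 < a.
Hypothesis r10 : 10 <= r.
Hypothesis hi_r : hi <= r.
Hypothesis P_r : P + 2 <= r.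
Hypothesis r_valid : 100 * c ^ c <= r ^ c.
Notation char := ('I_c * Phi)%type.

Lemma key_count_big n : r <= n -> key_count_valid (nat2N c) (nat2N n) 1.
Proof.
move=> rn; apply/key_count_validP; rewrite !Nat2N.id mul1n; split; first exact: leq_trans rn.
by apply: leq_trans r_valid _; rewrite leq_exp2r //; lia.
Qed.

Lemma candidates_keys_div (C : {set char}) E g x y : 0 < y -> nkeys C * y <= x ->
  100 * y <= x ->
  exists2 N0, #|candidates d x0 100 C E g| <= 'C(N0, 100) * 'C(d * 'C(100, 2), g) & N0 * y <= x.
Proof.
move=> y0 h1 h2; exists (x %/ y); last exact: leq_divM.
by apply: card_candidates_keys; rewrite leq_divRL.
Qed.

Lemma exponent_levelP (C : {set char}) : 2 < #|C| ->
  'C(c * 2 ^ a, #|C|) * #|candidates d x0 100 C [set set0] (min_gain_level #|C|)| * 2 ^ N.to_nat K <=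
    2 ^ N.to_nat (exponent_level #|C|) * 2 ^ (m * min_gain_level #|C|).
Proof.
move=> C2; have sC : \sum_(i in [set: 'I_c]) #|fiber C i| = #|C|.
  by rewrite -[RHS]card_fibers; apply: eq_bigl => i; rewrite inE.
have cI : #|[set: 'I_c]| = c by rewrite cardsT card_ord.
have set0C : [set set0] \subset kdiffs C.
  rewrite sub1set inE sub0set; apply/forallP => i; apply/orP; left.
  by apply/eqP/setP => x; rewrite !inE.
apply: costP => //; first exact: log_le_prefactor.
- move=> Cr; apply: (leq_trans (card_candidates_vectors _ _ _ _ set0C)).
  rewrite leq_bin2l // cards1 to_natM Nat2N.id leq_mul2l; apply/orP; right.
  have hA : #|[set: 'I_c]| = (c - 1).+1 by rewrite cI; lia.
  have := @vector_tableP _ _ (fun i => #|fiber C i|) r _ hA.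
  rewrite sC -V_eq => /(_ Cr) h.
  suff : nvectors C <= N.to_nat (nth 0%num V #|C|) by lia.
  by apply: leq_trans h; rewrite /nvectors leq_eqVlt; apply/orP; left; apply/eqP/eq_bigl => i; rewrite inE.
- move=> /key_count_validP[]; rewrite !Nat2N.id mul1n => h1 h2.
  apply: candidates_keys_div h2; first by rewrite expn_gt0 ltnW.
  have := @prod_max1_leq _ [set: 'I_c] (fun i => #|fiber C i|).
  rewrite sC cI => /(_ c4 h1); congr (_ * _ <= _).
  by apply: eq_bigl => i; rewrite inE.
- lia.
by case: leqP => //= h; apply: key_count_big; apply: ltnW.
Qed.

Section PairLevel.
Variables (i : 'I_c) (B : {set Phi}) (C : {set char}).
Hypothesis B2 : #|B| = 2.
Hypothesis CB : [disjoint C & pair_set i B].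
Let U := C :|: pair_set i B.
Let E := [set set0; pair_set i B].
Let n := #|C|.
Let p := #|fiber C i|.

Lemma card_pair_set : #|pair_set i B| = 2.
Proof. by rewrite card_imset // => x y []. Qed.

Lemma card_fiber_union i' : #|fiber U i'| = #|fiber C i'| + (i' == i) * 2.
Proof.
have -> : fiber U i' = fiber C i' :|: fiber (pair_set i B) i'.
  by apply/setP => x; rewrite !inE.
rewrite cardsU [_ :&: _](_ : _ = set0) ?cards0 ?subn0; last first.
  apply/setP => x; rewrite !inE; apply/negbTE/negP => /andP[xC xB].
  by have := disjointFr CB xC; rewrite xB.
by rewrite fiber_pair_set; case: eqP => _; rewrite ?B2 ?cards0.
Qed.

Lemma card_union_pair : #|U| = n + 2.
Proof. by rewrite cardsU (disjoint_setI0 CB) cards0 subn0 card_pair_set. Qed.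

Lemma excluded_kdiffs : E \subset kdiffs U /\ #|E| = 2.
Proof.
split; last first.
  by rewrite cards2 eq_sym -card_gt0 card_pair_set.
apply/subsetP => S /set2P[] ->; rewrite inE ?sub0set ?subsetUr /=; apply/forallP => i'.
  by apply/orP; left; apply/eqP/setP => x; rewrite !inE.
by rewrite fiber_pair_set; case: (i' == i); rewrite ?B2 ?eqxx ?orbT.
Qed.

Lemma others_card : #|[set~ i]| = c - 1.
Proof. by rewrite cardsC1 card_ord subn1. Qed.

Lemma others_sum : \sum_(i' in [set~ i]) #|fiber C i'| = n - p.
Proof.
rewrite /n -(card_fibers C) [in RHS](bigD1 i) //= /p addKn.
by apply: eq_bigl => i'; rewrite !inE.
Qed.

Lemma prod_union (f : nat -> nat) :
  \prod_(i' < c) f #|fiber U i'| = f (p + 2) * \prod_(i' in [set~ i]) f #|fiber C i'|.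
Proof.
rewrite (bigD1 i) //= card_fiber_union eqxx mul1n; congr (_ * _).
rewrite (eq_bigl (fun i' => i' \in [set~ i])); last by move=> i'; rewrite !inE.
by apply: eq_bigr => i'; rewrite !inE card_fiber_union => /negPf ->; rewrite addn0.
Qed.

Lemma exponent_pair_levelP s :
  c * 'C(2 ^ a, 2) * 'C(d, s) * 'C(c * 2 ^ a, n) *
    #|candidates d x0 100 U E (min_gain_pair s n p)| * 2 ^ N.to_nat K <=
  2 ^ N.to_nat (exponent_pair_level s n) * 2 ^ (m * (s + min_gain_pair s n p)).
Proof.
have [EU E2] := excluded_kdiffs.
rewrite /min_gain_pair; set p' := minn p (classes n).
apply: (@leq_trans (2 ^ N.to_nat (exponent_class s n p') *
    2 ^ (m * (s + N.to_nat (gain_pair (nat2N s) (nat2N n) (nat2N p')))))); last first.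
  rewrite leq_mul2r leq_exp2l //; apply/orP; right.
  by apply: max_uptoP; rewrite geq_minr.
set g := gain_pair _ _ _; rewrite /exponent_class -/g.
have -> : s + N.to_nat g = N.to_nat (nat2N s + g)%num by rewrite to_natD Nat2N.id.
have pn : p <= n by rewrite /n -(card_fibers C) (bigD1 i) //= leq_addr.
have pre : log_le (c * 'C(2 ^ a, 2) * 'C(d, s) * 'C(c * 2 ^ a, n))
    (N.to_nat (log_pair + log_ffact d s + prefactor (nat2N n)))
    (N.to_nat (fl (nat2N s) + fl (nat2N n))).
  rewrite (to_natD _ (prefactor _)) (to_natD (fl _)).
  exact: log_le_mul (log_le_pair s a0) (log_le_prefactor n).
have vec : forall M : N, nvectors U - 2 <= N.to_nat M ->
    #|candidates d x0 100 U E (N.to_nat g)| <= 'C(N.to_nat (nat2N d * M), N.to_nat g).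
  move=> M h; apply: (leq_trans (card_candidates_vectors _ _ _ _ EU)).
  by rewrite leq_bin2l // E2 to_natM Nat2N.id leq_mul2l h orbT.
case: ifP => [pc|_].
  have p'p : p' = p by rewrite /p' in pc *; case: (leqP p (classes n)) pc => //; rewrite ltnn.
  have nr : n <= r.
    move: pc; rewrite /classes; case: ifP => // /andP[_ h] _; exact: leq_trans hi_r.
  have pP : p + 2 <= r.
    move: pc; rewrite p'p /classes; case: ifP => // _ h; lia.
  have eN : (nat2N n - nat2N p')%num = nat2N (n - p) by rewrite p'p; lia.
  have ec : (nat2N c - 1)%num = nat2N (c - 1) by lia.
  apply: costP => //.
  - move=> _; apply: vec; rewrite p'p.
    suff : nvectors U <= N.to_nat (nth 0%num W (p + 2) * nth 0%num V1 (n - p))%num by lia.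
    rewrite to_natM.
    rewrite /nvectors (prod_union pairs1); apply: leq_mul.
      by rewrite W_eq (@pairs1_tableP _ 0 1).
    have hA : #|[set~ i]| = (c - 2).+1 by rewrite others_card; lia.
    have := @vector_tableP _ _ (fun i => #|fiber C i|) r _ hA.
    rewrite others_sum -V1_eq; apply; lia.
  - rewrite eN ec => /key_count_validP[]; rewrite !Nat2N.id => h1 h2.
    apply: candidates_keys_div => //; first by rewrite expn_gt0; lia.
    rewrite /nkeys (prod_union (fun x => maxn x 1)) -mulnA to_natD Nat2N.id p'p.
    rewrite (maxn_idPl _) ?addn2 // leq_mul2l; apply/orP; right.
    have := @prod_max1_leq _ [set~ i] (fun i => #|fiber C i|).
    by rewrite others_card others_sum; apply=> //; lia.
  - lia.
have e2 : (nat2N n + 2)%num = nat2N (n + 2) by lia.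
have sU : \sum_(i' in [set: 'I_c]) #|fiber U i'| = n + 2.
  by rewrite -card_union_pair -card_fibers; apply: eq_bigl => i'; rewrite inE.
have cI : #|[set: 'I_c]| = c by rewrite cardsT card_ord.
apply: costP => //.
- move=> nr; apply: vec.
  suff : nvectors U <= N.to_nat (nth 0%num V (n + 2)) by lia.
  have hA : #|[set: 'I_c]| = (c - 1).+1 by rewrite cI; lia.
  have := @vector_tableP _ _ (fun i => #|fiber U i|) r _ hA.
  rewrite sU -V_eq => /(_ nr) h; apply: leq_trans h; rewrite /nvectors leq_eqVlt.
  by apply/orP; left; apply/eqP/eq_bigl => i'; rewrite inE.
- rewrite e2 => /key_count_validP[]; rewrite !Nat2N.id mul1n => h1 h2.
  apply: candidates_keys_div h2; first by rewrite expn_gt0 ltnW.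
  have := @prod_max1_leq _ [set: 'I_c] (fun i => #|fiber U i|).
  rewrite sU cI => /(_ c4 h1); congr (_ * _ <= _).
  by apply: eq_bigl => i'; rewrite inE.
- lia.
by rewrite e2; case: leqP => //= h; apply: key_count_big; apply: ltnW.
Qed.

End PairLevel.
End Sound.
End Certificate.

(** * Summation of the terms and the three parameter sets *)

Section Total.
Local Open Scope nat_scope.

Fixpoint sum_exp2 (f : nat -> N) (n i : nat) : N :=
  if n is n'.+1 then (N.shiftl 1 (f i) + sum_exp2 f n' i.+1)%num else 0%num.

Lemma sum_exp2P f n i :
  N.to_nat (sum_exp2 f n i) = \sum_(i <= j < i + n) 2 ^ N.to_nat (f j).
Proof.
elim: n i => [|n IH] i; first by rewrite addn0 big_geq.
rewrite big_ltn ?addnS ?ltnS ?leq_addr // -addSn -IH -to_nat_exp2 -N.shiftl_1_l.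
exact: to_natD.
Qed.

Fixpoint sum_if (b : pred nat) (f : nat -> N) (n : nat) : N :=
  if n is n'.+1 then (if b n' then (f n' + sum_if b f n')%num else sum_if b f n') else 0%num.

Lemma sum_ifP b f n : N.to_nat (sum_if b f n) = \sum_(0 <= j < n | b j) N.to_nat (f j).
Proof.
elim: n => [|n IH]; first by rewrite big_geq.
rewrite big_mkcond big_nat_recr //= -big_mkcond -IH.
by case: (b n); rewrite ?addn0 // to_natD addnC.
Qed.

(* An upper bound for 2^K times the probability that h is not 100-unique. *)
Definition total_bound (c d a m smax P lo hi r : nat) (K : N) : N :=
  let V := vector_table r (c - 1) in
  let V1 := vector_table r (c - 2) in
  let W := vector_table r 0 in
  let tab := fact_logs 200 0 0 in
  (N.shiftl 1 (exponent_pair c d a m smax K tab) +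
   (sum_exp2 (exponent_level c d a m r K V tab) (c * 100 - 2)%N 3 +
    sum_if (fun s => d < c * s)%N
      (fun s => sum_exp2 (exponent_pair_level c d a m P lo hi r K V V1 W tab s) (c * 100)%N 1) smax.+1))%num.

End Total.

Lemma natr_div_le (R : realFieldType) (x D E q s g : nat) : (0 < D)%N -> (0 < q)%N ->
  (D * x <= E * q ^ (s + g))%N ->
  x%:R * q%:R^-1 ^+ g <= E%:R / D%:R * q%:R ^+ s :> R.
Proof.
move=> D0 q0 le; have qR : 0 < q%:R :> R by rewrite ltr0n.
have DR : 0 < D%:R :> R by rewrite ltr0n.
rewrite exprVn ler_pdivrMr ?exprn_gt0 // -(mulrA (E%:R / D%:R)) -exprD mulrAC ler_pdivlMr //.
by rewrite -natrX -!natrM ler_nat mulnC.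
Qed.

Theorem prob_not_kunique_total (R : realFieldType) (Phi : finType) (c d a m smax P lo hi r : nat)
    (K den tgt : N) (ps : 'I_c -> {ffun Phi -> Out m d} -> R) :
  (1 < c)%N -> (c <= 4)%N -> (6 < a)%N -> (hi <= r)%N -> (P + 2 <= r)%N -> (smax < d)%N ->
  key_count_valid (N.of_nat c) (N.of_nat r) 1 ->
  (0 < den)%num ->
  (total_bound c d a m smax P lo hi r K * den <=? tgt * 2 ^ K)%num ->
  #|Phi| = (2 ^ a)%N -> (forall i, random_table 100 (ps i)) ->
  prob_not_kunique 100 ps <= (N.to_nat tgt)%:R / (N.to_nat den)%:R.
Proof.
move=> c2 c4 a6 hi_r P_r smax_d rv den0 chk cardPhi hps.
have [r10 r_valid] : (10 <= r /\ 100 * c ^ c <= r ^ c)%N.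
  have /key_count_validP[] := rv; rewrite !Nat2N.id mul1n => h1 h2; split; [exact: h1 | exact: h2].
have hPhi : (100 <= #|Phi|)%N.
  by rewrite cardPhi; apply: (@leq_trans (2 ^ 7)); rewrite // leq_exp2l.
have [x0 _] : exists x0 : Phi, x0 \in Phi by apply/card_gt0P; apply: leq_trans hPhi.
have d0 : (0 < d)%N by apply: leq_trans smax_d.
have qE : #|{: Psi m}| = (2 ^ m)%N by rewrite card_ffun card_bool card_ord.
have [V [V1 [W [tab [V_eq V1_eq W_eq tab_eq totE]]]]] : exists V V1 W tab,
    [/\ V = vector_table r (c - 1), V1 = vector_table r (c - 2), W = vector_table r 0,
      tab = fact_logs 200 0 0 & total_bound c d a m smax P lo hi r K =
  (N.shiftl 1 (exponent_pair c d a m smax K tab) +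
   (sum_exp2 (exponent_level c d a m r K V tab) (c * 100 - 2)%N 3 +
    sum_if (fun s => d < c * s)%N
      (fun s => sum_exp2 (exponent_pair_level c d a m P lo hi r K V V1 W tab s) (c * 100)%N 1) smax.+1))%num].
  by do 4!eexists; split; try reflexivity.
set eP := exponent_pair c d a m smax K tab.
set eA := exponent_level c d a m r K V tab.
set eB := exponent_pair_level c d a m P lo hi r K V V1 W tab.
pose k2 := (2 ^ N.to_nat K)%N.
have k2_gt0 : (0 < k2)%N by rewrite expn_gt0.
have a0 : (0 < a)%N by apply: leq_trans a6.
(* [MA] and [MB] are the certified terms divided by the factors that the union bound multiplies
   back. *)
pose MA n : R := (2 ^ N.to_nat (eA n))%:R / ('C(c * 2 ^ a, n) * k2)%:R.
pose X s := (c * 'C(2 ^ a, 2) * 'C(d, s))%N.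
pose MB s n : R := (2 ^ N.to_nat (eB s n))%:R / (X s * 'C(c * 2 ^ a, n) * k2)%:R * (2 ^ m)%:R ^+ s.
have cC (C : {set 'I_c * Phi}) : (0 < 'C(c * 2 ^ a, #|C|))%N.
  by rewrite bin_gt0 -cardPhi -card_char max_card.
have MA0 n : 0 <= MA n by rewrite divr_ge0.
have MB0 s n : 0 <= MB s n by rewrite mulr_ge0 ?exprn_ge0 ?divr_ge0.
have gA_le n G := @min_gain_levelP c d n G c2.
have gB_le s n p G := @min_gain_pairP c d P lo hi s n p G c2.
apply: le_trans (prob_not_kunique_le hps hPhi (x0 := x0) (smax := smax)
  (gA := min_gain_level c d) (gB := min_gain_pair c d P lo hi) (MA := MA) (MB := MB)
  _ c2 d0 _ _ MA0 MB0 _ _) _ => //.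
- by move=> n G _; apply: gA_le.
- by move=> s n p G h _; apply: gB_le.
- move=> C C2; rewrite qE.
  have := @exponent_levelP c d a m P hi r K V tab V_eq tab_eq Phi x0 c2 c4 a0 r10 hi_r P_r r_valid C C2.
  rewrite mulnAC => h; rewrite /MA -[leRHS]mulr1 -[1](expr0 (2 ^ m)%:R).
  by apply: natr_div_le; rewrite ?muln_gt0 ?cC ?expn_gt0 // add0n -expnM.
- move=> i B s C B2 ds sm C0 CB; rewrite qE.
  have := @exponent_pair_levelP c d a m P lo hi r K V V1 W tab V_eq V1_eq W_eq tab_eq
     Phi x0 c2 c4 a0 r10 hi_r P_r r_valid i B C B2 CB s.
  rewrite mulnAC => h; apply: natr_div_le; last by rewrite -expnM.
    rewrite !muln_gt0 cC k2_gt0 !bin_gt0 (leq_trans sm (ltnW smax_d)) !andbT.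
    by rewrite (ltnW c2) -cardPhi; apply: leq_trans hPhi.
  by rewrite expn_gt0.
rewrite qE cardPhi.
set S := (2 ^ N.to_nat eP + (\sum_(3 <= n < (c * 100).+1) 2 ^ N.to_nat (eA n) +
  \sum_(0 <= s < smax.+1 | (d < c * s)%N) \sum_(1 <= n < (c * 100).+1) 2 ^ N.to_nat (eB s n)))%N.
have tE : N.to_nat (total_bound c d a m smax P lo hi r K) = S.
  rewrite totE (to_natD _ (_ + _)) (to_natD (sum_exp2 _ _ _)) N.shiftl_1_l to_nat_exp2 sum_exp2P sum_ifP.
  congr (_ + (_ + _))%N; first by congr bigop; congr index_iota; lia.
  by apply: eq_bigr => s _; rewrite sum_exp2P.
have SR : S%:R / k2%:R <= (N.to_nat tgt)%:R / (N.to_nat den)%:R :> R.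
  have den0' : 0 < (N.to_nat den)%:R :> R by rewrite ltr0n; lia.
  have k20 : 0 < k2%:R :> R by rewrite ltr0n.
  rewrite ler_pdivrMr // mulrAC ler_pdivlMr // -!natrM ler_nat -tE /k2 -to_nat_exp2 -!to_natM.
  by move/N.leb_le: chk; lia.
apply: le_trans SR; rewrite /S !natrD !mulrDl.
have q0 : (0 < 2 ^ m)%N by rewrite expn_gt0.
apply: lerD; last apply: lerD.
- have := @exponentP m K _ _ _ (N.of_nat smax.+1) (log_le_pair c d tab_eq smax.+1 a0).
  rewrite Nat2N.id expnM mulnC => h.
  by have := @natr_div_le R _ _ _ (2 ^ m) 0 smax.+1 k2_gt0 q0 h; rewrite expr0 mulr1.
- rewrite natr_sum mulr_suml; apply: ler_sum => n _; rewrite /MA.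
  have [->|C0] := posnP 'C(c * 2 ^ a, n); first by rewrite mul0r divr_ge0.
  by rewrite natrM invfM [X in _ * X <= _]mulrCA mulVKf // pnatr_eq0 -lt0n.
rewrite natr_sum mulr_suml mulr_sumr; apply: ler_sum => s _.
rewrite natr_sum mulr_suml 3!mulr_sumr; apply: ler_sum => n _; rewrite /MB.
have qR : ((2 ^ m)%:R : R) != 0 by rewrite pnatr_eq0 -lt0n.
have [z|X0] := posnP (X s).
  rewrite !mulrA -natrM -/(X s) z !mul0r; exact: divr_ge0.
have [->|C0] := posnP 'C(c * 2 ^ a, n).
  by rewrite mul0r !mulr0 divr_ge0.
rewrite exprVn.
have nz x : (0 < x)%N -> x%:R != 0 :> R by rewrite pnatr_eq0 -lt0n.
have XE : (X s)%:R = (c * 'C(2 ^ a, 2))%:R * 'C(d, s)%:R :> R by rewrite -natrM.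
have := nz _ X0; rewrite XE mulf_eq0 negb_or => /andP[x1 x2].
rewrite [(X s * _ * _)%:R]natrM [(X s * _)%:R]natrM XE.
have E (x y q z e k : R) : x != 0 -> y != 0 -> q != 0 -> z != 0 -> k != 0 ->
    x * (y * (q^-1 * (z * (e / (x * y * z * k) * q)))) = e / k.
  by move=> h1 h2 h3 h4 h5; field; rewrite h1 h2 h3 h4 h5.
by rewrite le_eqVlt; apply/orP; left; apply/eqP/E => //; rewrite ?expf_neq0 ?nz.
Qed.

(** Probabilities are measured in units of 2^(-240), far below the target. P = 0 separates no fiber
    sizes; for c = 3 and c = 4 below, fibers of fewer than 2, resp. 6, chars are separated when C
    has 29 to 32, resp. 40 to 58, chars. *)
Lemma total_bound_2 : (total_bound 2 20 16 16 11 0 0 0 34 240 * 10 ^ 43 <=? 15 * 2 ^ 240)%num.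
Proof. by vm_compute. Qed.

Lemma total_bound_3 : (total_bound 3 24 22 22 10 2 29 32 34 240 * 10 ^ 50 <=? 14 * 2 ^ 240)%num.
Proof. by vm_compute. Qed.

Lemma total_bound_4 : (total_bound 4 14 16 32 5 6 40 58 60 240 * 10 ^ 37 <=? 90 * 2 ^ 240)%num.
Proof. by vm_compute. Qed.

Lemma natr_to_nat_pow (R : realFieldType) (x n : N) :
  (N.to_nat (x ^ n)%num)%:R = (N.to_nat x)%:R ^+ N.to_nat n :> R.
Proof. by rewrite N2Nat.inj_pow expn_pow natrX. Qed.

Theorem theorem4 :
  (forall (R : realFieldType)
          (ps : 'I_2 -> {ffun 'I_(2 ^ 16) -> Out 16 20} -> R),
      (forall i, random_table 100 (ps i)) ->
      prob_not_kunique 100 ps <= 15%:R / 10%:R ^+ 43) /\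
  (forall (R : realFieldType)
          (ps : 'I_3 -> {ffun 'I_(2 ^ 22) -> Out 22 24} -> R),
      (forall i, random_table 100 (ps i)) ->
      prob_not_kunique 100 ps <= 14%:R / 10%:R ^+ 50) /\
  (forall (R : realFieldType)
          (ps : 'I_4 -> {ffun 'I_(2 ^ 16) -> Out 32 14} -> R),
      (forall i, random_table 100 (ps i)) ->
      prob_not_kunique 100 ps <= 90%:R / 10%:R ^+ 37).
Proof.
split; [|split] => R ps hps.
- have := @prob_not_kunique_total R _ 2 20 16 16 11 0 0 0 34 240 (10 ^ 43)%num 15 ps
    isT isT isT isT isT isT isT (erefl _) total_bound_2 (card_ord _) hps.
  by rewrite natr_to_nat_pow.
- have := @prob_not_kunique_total R _ 3 24 22 22 10 2 29 32 34 240 (10 ^ 50)%num 14 ps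
    isT isT isT isT isT isT isT (erefl _) total_bound_3 (card_ord _) hps.
  by rewrite natr_to_nat_pow.
- have := @prob_not_kunique_total R _ 4 14 16 32 5 6 40 58 60 240 (10 ^ 37)%num 90 ps
    isT isT isT isT isT isT isT (erefl _) total_bound_4 (card_ord _) hps.
  by rewrite natr_to_nat_pow.
Qed.
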